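(* Let $N=(D=(V\cup \{s\},A),\tau)$ be a consistent pre-flow temporal network. Then there exist $d^+_D(s)$ pairwise arc-disjoint $\tau$-respecting $s$-arborescences in $D$ such that each vertex $v\in V$ belongs to exactly $\lambda_N(s,v)$ of them.
   Context: A temporal network is a pair $N=(D,\tau)$ where $D=(V\cup\{s\},A)$ is a directed graph (parallel arcs allowed) with a root $s$ that no arc enters, and $\tau:A\to\mathbb{N}$. $d^+_D(s)$ is the number of arcs leaving $s$. For $i\in\mathbb{N}$, $\rho_N^i(v)=\{a \text{ entering } v:\tau(a)\le i\}$, $\delta_N^i(v)=\{a\text{ leaving } v:\tau(a)\le i\}$; $N$ is pre-flow if $|\rho_N^i(v)|\ge|\delta_N^i(v)|$ for all $i\in\mathbb{N}$, $v\in V$. $N$ is consistent if any two arcs lying in the same strongly connected component of $D$ have the same $\tau$-value. A directed path with arcs $a_1,\dots,a_\ell$ in order is $\tau$-respecting if $\tau(a_1)\le\dots\le\tau(a_\ell)$; $\lambda_N(s,v)$ is the maximum number of pairwise arc-disjoint $\tau$-respecting $(s,v)$-paths. An $s$-arborescence is an acyclic subgraph $F=(V'\cup\{s\},A')$, $V'\subseteq V$, in which each vertex of $V'$ has in-degree exactly $1$ (not necessarily spanning); it is $\tau$-respecting if for each of its vertices $v$ the unique $(s,v)$-path in $F$ is $\tau$-respecting. *)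

(* Defs.v *)
From mathcomp Require Import all_boot.
Set Implicit Arguments. Unset Strict Implicit. Unset Printing Implicit Defensive.

(* A temporal network: vertex type T (= V ∪ {s}), arc type Arc (parallel arcs
   allowed, as distinct elements of Arc with the same tail/head), tail/head
   maps, root s, time labels tau. *)
Section TemporalNetwork.
Variables (T Arc : finType) (tail head : Arc -> T) (s : T) (tau : Arc -> nat).

Definition adj : rel T := fun x y => [exists a, (tail a == x) && (head a == y)].

Definition root_ok : Prop := forall a, head a != s.

Definition rho (i : nat) (v : T) : {set Arc} := [set a | (head a == v) && (tau a <= i)].
Definition delta (i : nat) (v : T) : {set Arc} := [set a | (tail a == v) && (tau a <= i)].

Definition preflow : Prop :=
  forall (i : nat) (v : T), v != s -> #|delta i v| <= #|rho i v|.

(* arc a lies in a strongly connected component: its two ends are mutually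
   reachable (its head reaches its tail, the arc gives the converse) *)
Definition arc_in_scc (a : Arc) : bool := connect adj (head a) (tail a).

Definition same_scc (a b : Arc) : bool :=
  [&& arc_in_scc a, arc_in_scc b, connect adj (tail a) (tail b)
    & connect adj (tail b) (tail a)].

Definition consistent : Prop :=
  forall a b, same_scc a b -> tau a = tau b.

Fixpoint is_walk (x : T) (p : seq Arc) (y : T) : bool :=
  match p with
  | [::] => x == y
  | a :: p' => (tail a == x) && is_walk (head a) p' y
  end.

Definition is_path (x : T) (p : seq Arc) (y : T) : bool :=
  is_walk x p y && uniq (x :: map head p).

Definition tau_respecting (p : seq Arc) : bool := sorted leq (map tau p).

Definition disjoint_paths (v : T) (k : nat) : Prop :=
  exists ps : seq (seq Arc),
    [/\ size ps = k,
        all (fun p => is_path s p v && tau_respecting p) ps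
      & pairwise (fun p q => ~~ has (fun a => a \in q) p) ps].

Definition is_lambda (v : T) (k : nat) : Prop :=
  disjoint_paths v k /\ (forall k', disjoint_paths v k' -> k' <= k).

(* An s-arborescence given by its arc set F: vertex set is {s} ∪ V' where
   V' = heads of arcs in F; every arc of F starts in the vertex set, every
   vertex of V' has in-degree exactly 1 in F (s has in-degree 0 since no arc
   enters s), and F has no directed cycle. *)
Definition in_arbo (F : {set Arc}) (v : T) : bool := [exists a in F, head a == v].

Definition arborescence (F : {set Arc}) : Prop :=
  [/\ (forall a, a \in F -> (tail a == s) || in_arbo F (tail a)),
      (forall v, in_arbo F v -> #|[set a in F | head a == v]| = 1)
    & (forall (x : T) (p : seq Arc), p != [::] -> all (fun a => a \in F) p ->
         ~~ is_walk x p x)].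

Definition tau_arborescence (F : {set Arc}) : Prop :=
  arborescence F /\
  (forall (v : T) (p : seq Arc), all (fun a => a \in F) p -> is_path s p v ->
     tau_respecting p).

End TemporalNetwork.

(* Main.v *)
Require Import Defs.
From mathcomp Require Import all_boot.
From mathcomp Require Import zify.
Set Implicit Arguments. Unset Strict Implicit. Unset Printing Implicit Defensive.

(** By the pre-flow condition the arcs leaving a vertex can be matched injectively
    to earlier arcs entering it. Hence every arc entering a strongly connected
    component [C] is the end of its own path from [s], and the components can be
    handled one after the other: given arborescences for the vertices after [C],
    indexed by the arcs entering that set, one needs a packing inside [C], indexed
    by the arcs entering [C], in which every arc leaving [C] is attached to a
    branching of its own.

    All arcs inside [C] have the same time [t], so this is a static problem, a
    variant of a theorem of Bang-Jensen, Frank and Jackson: the arcs entering [C]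
    by time [t] become terminals of out-degree at most 2, and the arcs leaving [C]
    are directed to a sink. It is solved by induction on the number of vertices.
    For a vertex [v] of minimum demand, each arc [vu] is replaced by [zu] for some
    arc [zv], so that no cut falls below its demand; this is possible because the
    tight sets obstructing all choices of [zv] could be uncrossed using the
    pre-flow condition. A packing of the smaller network is lifted, and if [v] is
    not covered often enough, some unused arc [zv] extends a branching containing
    [z] but not [v], because the demand of [z] is at least that of [v].
    Only the trivial inequality between cuts and disjoint paths is needed, never
    Menger's theorem. *)

Lemma sum_bool_card (I : finType) (A : {set I}) (P : pred I) :
  \sum_(a in A) (P a : nat) = #|[set a in A | P a]|.
Proof.
rewrite -sum1dep_card big_mkcondr /=.
by apply: eq_bigr => a _; case: (P a).
Qed.

Lemma card_le_inj (I J : finType) (D : {set I}) (E : {set J}) (h : I -> J) :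
  {in D &, injective h} -> (forall x, x \in D -> h x \in E) -> #|D| <= #|E|.
Proof.
move=> inj hE; rewrite -(card_in_imset inj); apply/subset_leq_card/subsetP.
by move=> _ /imsetP[x xD ->]; apply: hE.
Qed.

(** * Packing arborescences in a static network with terminals *)

Section Terminals.
Variables (T Arc : finType) (hd : Arc -> T) (S : {set T}).
Implicit Types (tl : Arc -> T) (A : {set Arc}) (X Y Z V P : {set T}).

Definition hits tl A y X := [exists a in A, (tl a == y) && (hd a \in X)].
Definition enters tl X a := [&& hd a \in X, tl a \notin X & tl a \notin S].
(** This bounds the number of arc-disjoint arborescences, with distinct terminals as roots, that can
    meet a set [X] without terminals. A terminal roots only one of them, so it counts once however
    many of its arcs end in [X]. *)
Definition cut tl A X : nat :=
  \sum_(y in S) hits tl A y X + \sum_(a in A) enters tl X a.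
Definition outs tl A x := [set a in A | tl a == x].
Definition ins A x := [set a in A | hd a == x].

Definition network V tl A :=
  [/\ forall y, y \in S -> y \notin V,
      forall a, a \in A -> hd a \in V /\ (tl a \in V) || (tl a \in S),
      forall x, x \in V -> #|outs tl A x| <= #|ins A x|
    & forall y, y \in S -> #|outs tl A y| <= 2].

Lemma hitsP tl A y X :
  reflect (exists a, [/\ a \in A, tl a = y & hd a \in X]) (hits tl A y X).
Proof.
apply: (iffP exists_inP) => [[a aA /andP[/eqP e h]]|[a [aA e h]]]; exists a => //.
by rewrite e eqxx.
Qed.

Lemma hits_sub tl A y X Y : X \subset Y -> hits tl A y X -> hits tl A y Y.
Proof.
move=> sXY /hitsP[a [aA e h]]; apply/hitsP; exists a; split => //.
exact: (subsetP sXY).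
Qed.

Lemma hitsU tl A y X Y : hits tl A y (X :|: Y) = hits tl A y X || hits tl A y Y.
Proof.
apply/idP/orP => [/hitsP[a [aA e]]|[]].
- by rewrite inE => /orP[] h; [left|right]; apply/hitsP; exists a.
- exact/hits_sub/subsetUl.
- exact/hits_sub/subsetUr.
Qed.

Lemma eq_cut tl A tl' A' X :
    (forall a, hd a \in X -> (a \in A') = (a \in A)) ->
    (forall a, hd a \in X -> a \in A -> tl' a = tl a) ->
  cut tl' A' X = cut tl A X.
Proof.
move=> eA etl; congr (_ + _).
  apply: eq_bigr => y _; congr nat_of_bool; apply/hitsP/hitsP => -[a [aA e h]].
    by exists a; rewrite -etl -?eA.
  by exists a; rewrite etl ?eA.
rewrite !sum_bool_card; congr #|pred_of_set _|; apply/setP => a.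
rewrite !inE /enters; case: (boolP (hd a \in X)) => h; rewrite ?andbF //= eA //.
by case: (boolP (a \in A)) => //= aA; rewrite etl.
Qed.

(** * Uncrossing inequalities for cuts *)

Definition crossing tl X Y a := [&& tl a \notin S, tl a \in X & hd a \in Y].

(** The surplus of arcs from [X :\: Y] to [Y :\: X] is kept because the inequality becomes strict
    when the arc to be split is one of them. *)
Lemma cut_submodular tl A X Y :
  cut tl A (X :&: Y) + cut tl A (X :|: Y)
    + \sum_(a in A) crossing tl (X :\: Y) (Y :\: X) a
  <= cut tl A X + cut tl A Y.
Proof.
rewrite /cut.
have h1 : \sum_(y in S) hits tl A y (X :&: Y) + \sum_(y in S) hits tl A y (X :|: Y)
   <= \sum_(y in S) hits tl A y X + \sum_(y in S) hits tl A y Y.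
  rewrite -!big_split; apply: leq_sum => y _ /=; rewrite hitsU.
  have := @hits_sub tl A y _ _ (subsetIl X Y).
  have := @hits_sub tl A y _ _ (subsetIr X Y).
  case: (hits _ _ _ (_ :&: _)) => [/(_ isT) -> /(_ isT) -> //|_ _].
  by case: (hits _ _ _ X); case: (hits _ _ _ Y).
have h2 : \sum_(a in A) enters tl (X :&: Y) a + \sum_(a in A) enters tl (X :|: Y) a
    + \sum_(a in A) crossing tl (X :\: Y) (Y :\: X) a
   <= \sum_(a in A) enters tl X a + \sum_(a in A) enters tl Y a.
  rewrite -!big_split; apply: leq_sum => a _; rewrite /enters /crossing !inE.
  by case: (tl a \in S); case: (tl a \in X); case: (tl a \in Y);
     case: (hd a \in X); case: (hd a \in Y).
lia.
Qed.

Lemma sum_tail tl A (P : pred Arc) :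
  \sum_(y in S) #|[set a in A | (tl a == y) && P a]|
    = \sum_(a in A) ((tl a \in S) && P a).
Proof.
under eq_bigr => y _ do rewrite -sum_bool_card.
rewrite exchange_big; apply: eq_bigr => a _ /=.
case: (boolP (tl a \in S)) => h /=; last first.
  by apply: big1 => y yS; case: eqP => // e; rewrite e yS in h.
rewrite (bigD1 (tl a)) //= eqxx /= big1 ?addn0 // => y /andP[_].
by rewrite eq_sym => /negPf ->.
Qed.

Lemma preflow_set V tl A Z : network V tl A -> Z \subset V ->
  \sum_(a in A) (tl a \in Z) <= \sum_(a in A) (hd a \in Z).
Proof.
case=> _ _ hp _ sZ.
have E (f : Arc -> T) : \sum_(a in A) (f a \in Z) = \sum_(x in Z) #|[set a in A | f a == x]|.
  under [RHS]eq_bigr => y _ do rewrite -sum_bool_card.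
  rewrite exchange_big; apply: eq_bigr => a _ /=.
  case: (boolP (f a \in Z)) => h /=; last first.
    by rewrite big1 // => y yS; case: eqP => // e; rewrite e yS in h.
  rewrite (bigD1 (f a)) //= eqxx /= big1 ?addn0 // => y /andP[_].
  by rewrite eq_sym => /negPf ->.
rewrite !E; apply: leq_sum => x xZ; apply: hp; exact: (subsetP sZ).
Qed.

Lemma hits_le tl A y X : hits tl A y X <= #|[set a in A | (tl a == y) && (hd a \in X)]|.
Proof.
case: hitsP => //= -[a [aA e h]]; apply/card_gt0P; exists a.
by rewrite !inE aA e eqxx h.
Qed.

(* A terminal meeting the intersection is counted twice on the right; since it
   has at most two arcs, this pays for its contribution to the other two sets. *)
Lemma hits_uncross tl A y X Y : #|outs tl A y| <= 2 ->
  hits tl A y (X :\: Y) + hits tl A y (Y :\: X)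
    + #|[set a in A | (tl a == y) && (hd a \in X :&: Y)]|
  <= hits tl A y X + hits tl A y Y.
Proof.
move=> d2.
have [e|] := posnP #|[set a in A | (tl a == y) && (hd a \in X :&: Y)]|.
  rewrite e addn0; apply: leq_add.
    by case: (hits _ _ _ (_ :\: _)) (@hits_sub tl A y _ _ (subsetDl X Y)) => // /(_ isT) ->.
  by case: (hits _ _ _ (_ :\: _)) (@hits_sub tl A y _ _ (subsetDl Y X)) => // /(_ isT) ->.
case/card_gt0P => a; rewrite !inE => /and3P[aA /eqP e /andP[hX hY]].
have -> : hits tl A y X by apply/hitsP; exists a.
have -> : hits tl A y Y by apply/hitsP; exists a.
apply: leq_trans d2.
have := @hits_le tl A y (X :\: Y); have := @hits_le tl A y (Y :\: X).
rewrite /outs -!sum_bool_card.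
suff : \sum_(a0 in A) ((tl a0 == y) && (hd a0 \in X :\: Y) : nat) +
  \sum_(a0 in A) ((tl a0 == y) && (hd a0 \in Y :\: X) : nat) +
  \sum_(a0 in A) ((tl a0 == y) && (hd a0 \in X :&: Y) : nat) <= \sum_(a0 in A) (tl a0 == y) by lia.
rewrite -!big_split; apply: leq_sum => b _; rewrite !inE.
by case: (tl b == y); case: (hd b \in X); case: (hd b \in Y).
Qed.

(** In-degrees uncross to the two differences up to the excess of arcs entering [X :&: Y] over arcs
    leaving it, which is nonnegative by the pre-flow condition. Terminal arcs into the intersection
    are part of this excess and are paid for by [hits_uncross]. *)
Lemma cut_uncross V tl A X Y : network V tl A -> X \subset V ->
  cut tl A (X :\: Y) + cut tl A (Y :\: X)
    + \sum_(a in A) (crossing tl (X :&: Y) (~: (X :|: Y)) a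
                     || crossing tl (~: (X :|: Y)) (X :&: Y) a)
  <= cut tl A X + cut tl A Y.
Proof.
move=> net sX; rewrite /cut.
have h0 := @preflow_set V tl A (X :&: Y) net (subset_trans (subsetIl _ _) sX).
have h1 : \sum_(y in S) hits tl A y (X :\: Y) + \sum_(y in S) hits tl A y (Y :\: X)
   + \sum_(a in A) ((tl a \in S) && (hd a \in X :&: Y))
   <= \sum_(y in S) hits tl A y X + \sum_(y in S) hits tl A y Y.
  rewrite -sum_tail -!big_split; apply: leq_sum => y yS.
  by apply: hits_uncross; case: net => _ _ _; apply.
have h2 : \sum_(a in A) enters tl (X :\: Y) a + \sum_(a in A) enters tl (Y :\: X) a
    + \sum_(a in A) (crossing tl (X :&: Y) (~: (X :|: Y)) a
                     || crossing tl (~: (X :|: Y)) (X :&: Y) a)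
    + \sum_(a in A) (hd a \in X :&: Y)
   <= \sum_(a in A) enters tl X a + \sum_(a in A) enters tl Y a
      + \sum_(a in A) (tl a \in X :&: Y)
      + \sum_(a in A) ((tl a \in S) && (hd a \in X :&: Y)).
  rewrite -!big_split; apply: leq_sum => a _; rewrite /enters /crossing !inE.
  by case: (tl a \in S); case: (tl a \in X); case: (tl a \in Y);
     case: (hd a \in X); case: (hd a \in Y).
lia.
Qed.

(** * Splitting off pairs of arcs at a vertex *)

Definition split_tail tl (a b : Arc) := fun x => if x == a then tl b else tl x.

(* Whether the far end of the in-arc [b] lies in [X]; an arc leaving a terminal
   behaves as if it came from the head of the terminal's other arc. *)
Definition origin_in tl A b X :=
  (tl b \in X) || ((tl b \in S) && hits tl (A :\ b) (tl b) X).

(** At most one unit is lost. If [X] contains [hd b] but not [hd a], the entry through [b] may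
    vanish without replacement; if it contains [hd a] but not [hd b], the entry through [a] vanishes
    when its new tail already counts as inside [X]. *)
Lemma cut_split tl A a b X :
    a \in A -> b \in A -> tl a = hd b -> hd b \notin S -> hd a != hd b ->
    (forall y, y \in S -> y \notin X) ->
  cut tl A X <= cut (split_tail tl a b) (A :\ b) X
    + ([&& hd b \in X, hd a \notin X & ~~ origin_in tl A b X]
       || [&& hd b \notin X, hd a \in X & origin_in tl A b X]).
Proof.
move=> aA bA ta vS nab dS.
have neab : a != b by apply: contraNneq nab => ->.
have aAb : a \in A :\ b by rewrite !inE neab.
have ta' : split_tail tl a b a = tl b by rewrite /split_tail eqxx.
have tx x : x != a -> split_tail tl a b x = tl x by rewrite /split_tail => /negPf ->.
rewrite /cut (big_setD1 b bA) (big_setD1 a aAb) [in leqRHS](big_setD1 a aAb) /=.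
have -> : \sum_(i in A :\ b :\ a) enters (split_tail tl a b) X i
        = \sum_(i in A :\ b :\ a) enters tl X i.
  by apply: eq_bigr => x; rewrite !inE /enters => /and3P[h _ _]; rewrite tx.
set rest := \sum_(i in A :\ b :\ a) _.
have hy y : y \in S -> y != tl b -> hits tl A y X <= hits (split_tail tl a b) (A :\ b) y X.
  move=> yS nyb; case: (hitsP tl A) => // -[x [xA ex hx]].
  suff -> : hits (split_tail tl a b) (A :\ b) y X by [].
  apply/hitsP; exists x.
  have nxa : x != a by apply: contraNneq vS => xa; rewrite -ta -xa ex.
  by split; rewrite ?tx // !inE xA andbT; apply: contraNneq nyb => <-; rewrite ex.
rewrite /enters ta' ta /origin_in.
have [zS|zS] := boolP (tl b \in S); last first.
  have : \sum_(y in S) hits tl A y X <= \sum_(y in S) hits (split_tail tl a b) (A :\ b) y X.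
    by apply: leq_sum => y yS; apply: hy => //; apply: contraNneq zS => <-.
  rewrite vS; set L := \sum_(y in S) _; set L' := \sum_(y in S) _ => hL.
  clear -hL; case: (hd a \in X); case: (hd b \in X); case: (tl b \in X) => /=; lia.
rewrite (bigD1 (tl b)) //= [in leqRHS](bigD1 (tl b)) //= (negPf (dS _ zS)) /=.
have hL : \sum_(y in S | y != tl b) hits tl A y X
   <= \sum_(y in S | y != tl b) hits (split_tail tl a b) (A :\ b) y X.
  by apply: leq_sum => y /andP[]; apply: hy.
have e1 : hits tl A (tl b) X = (hd b \in X) || hits tl (A :\ b) (tl b) X.
  apply/hitsP/orP => [[x [xA ex hx]]|[h|/hitsP[x [xA ex hx]]]].
  - have [xb|nxb] := eqVneq x b; [by left; rewrite -xb|right].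
    by apply/hitsP; exists x; rewrite !inE nxb.
  - by exists b.
  - by exists x; move: xA; rewrite !inE => /andP[].
have e2 : hits (split_tail tl a b) (A :\ b) (tl b) X
          = (hd a \in X) || hits tl (A :\ b) (tl b) X.
  apply/hitsP/orP => [[x [xA ex hx]]|[h|/hitsP[x [xA ex hx]]]].
  - have [xa|nxa] := eqVneq x a; [by left; rewrite -xa|right].
    by apply/hitsP; exists x; rewrite -tx.
  - by exists a.
  - exists x; split => //; rewrite tx //; apply: contraNneq vS => xa.
    by rewrite -ta -xa ex.
move: hL; rewrite e1 e2 vS; set L := \sum_(y in S | _) _; set L' := \sum_(y in S | _) _.
clear; case: (hd a \in X); case: (hd b \in X); case: (hits _ _ _ _) => /=; lia.
Qed.

Lemma origin_in_sub tl A b X Y :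
  X \subset Y -> origin_in tl A b X -> origin_in tl A b Y.
Proof.
move=> sXY /orP[h|/andP[h h']]; apply/orP; first by left; apply: (subsetP sXY).
by right; rewrite h; apply: hits_sub h'.
Qed.

(** A terminal with at most two arcs has at most one besides [b], so the origin of [b] behaves like
    a single vertex. *)
Lemma origin_inD tl A b X Y :
    b \in A -> (tl b \in S -> #|outs tl A (tl b)| <= 2) ->
    (forall y, y \in S -> y \notin X) -> (forall y, y \in S -> y \notin Y) ->
  origin_in tl A b (X :\: Y) -> origin_in tl A b X && ~~ origin_in tl A b Y.
Proof.
move=> bA d2 dX dY h; rewrite (origin_in_sub (subsetDl X Y) h) /=.
apply/negP => h'; move: h h'; rewrite /origin_in.
have [zS|zS] := boolP (tl b \in S); last first.
  by rewrite /= !orbF inE => /andP[/negPf ->].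
rewrite (negPf (dY _ zS)) inE (negPf (dX _ zS)) andbF /=.
case/hitsP => x [xA ex]; rewrite inE => /andP[hx _] /hitsP[x' [x'A ex' hx']].
have nxx : x != x' by apply: contraNneq hx => ->.
move: xA x'A; rewrite !inE => /andP[nxb xA] /andP[nx'b x'A].
have : #|[set b; x; x']| <= 2.
  apply: leq_trans (subset_leq_card _) (d2 zS); apply/subsetP => i.
  by rewrite !inE => /orP[/orP[]|] /eqP ->; rewrite ?bA ?xA ?x'A ?ex ?ex' ?eqxx.
by rewrite -setUA cardsU1 !inE cards2 nxx (eq_sym b) (negPf nxb) (eq_sym b) (negPf nx'b).
Qed.

(** Since all arcs entering [v] originate in [P], adding [v] creates no new entry, while [a] stops
    being one. *)
Lemma cut_add_vertex tl A P v a :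
    v \notin P -> v \notin S -> a \in A -> tl a = v -> hd a \in P ->
    (forall y, y \in S -> y \notin P) ->
    (forall b, b \in ins A v -> origin_in tl A b P) ->
  cut tl A (v |: P) < cut tl A P.
Proof.
move=> vP vS aA ta ha dP hb; rewrite /cut.
have inP x : x \in A -> hd x = v -> (tl x \in P) || ((tl x \in S) && hits tl (A :\ x) (tl x) P).
  by move=> xA hx; apply: hb; rewrite !inE xA hx eqxx.
have h1 : \sum_(y in S) hits tl A y (v |: P) <= \sum_(y in S) hits tl A y P.
  apply: leq_sum => y yS; case: (hitsP tl A y (v |: P)) => // -[x [xA ex hx]].
  suff -> : hits tl A y P by [].
  move: hx; rewrite !inE => /orP[/eqP hx|hx]; last by apply/hitsP; exists x.
  have := inP x xA hx; rewrite ex (negPf (dP _ yS)) yS /= => /hitsP[x' [x'A ex' hx']].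
  by apply/hitsP; exists x'; split => //; move: x'A; rewrite inE => /andP[].
have h2 : \sum_(x in A) enters tl (v |: P) x + \sum_(x in A) (x == a) <= \sum_(x in A) enters tl P x.
  rewrite -big_split; apply: leq_sum => x xA; rewrite /enters !inE.
  have [->|nxa] := eqVneq x a; first by rewrite ta vP vS ha eqxx andbF.
  have [hx|_] /= := eqVneq (hd x) v; last first.
    by case: (hd x \in P) => //=; case: (tl x == v) => //=; rewrite addn0.
  by case/orP: (inP x xA hx) => [->|/andP[->]]; rewrite ?orbT ?andbF.
have h3 : 0 < \sum_(x in A) (x == a) by rewrite (bigD1 a) //= eqxx.
clear -h1 h2 h3; lia.
Qed.

(** Each arc entering [v] contributes separately to the cut of [Z] and is lost with [v]. The only
    new entries are arcs from [v] into [Z]; as [a] is not among them, they are fewer than the arcs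
    entering [v]. *)
Lemma cut_del_vertex tl A Z v a :
    v \in Z -> v \notin S -> a \in A -> tl a = v -> hd a \notin Z ->
    #|outs tl A v| <= #|ins A v| ->
    (forall b, b \in ins A v -> ~~ origin_in tl A b Z) ->
  cut tl A (Z :\ v) < cut tl A Z.
Proof.
move=> vZ vS aA ta ha pf hb; rewrite /cut.
have inZ x : x \in A -> hd x = v -> (tl x \notin Z) && ~~ ((tl x \in S) && hits tl (A :\ x) (tl x) Z).
  by move=> xA hx; rewrite -negb_or; apply: hb; rewrite !inE xA hx eqxx.
have h0 : #|ins A v| = \sum_(y in S) #|[set x in A | (tl x == y) && (hd x == v)]|
    + \sum_(x in A) ((tl x \notin S) && (hd x == v)).
  rewrite sum_tail -sum_bool_card -big_split; apply: eq_bigr => x _ /=.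
  by case: (tl x \in S) => //=; rewrite addn0.
have h1 : \sum_(y in S) hits tl A y (Z :\ v)
          + \sum_(y in S) #|[set x in A | (tl x == y) && (hd x == v)]|
    <= \sum_(y in S) hits tl A y Z.
  rewrite -big_split; apply: leq_sum => y yS /=.
  have [e|] := posnP #|[set x in A | (tl x == y) && (hd x == v)]|.
    rewrite e addn0; have := @hits_sub tl A y _ _ (subsetDl Z [set v]).
    by case: (hits _ _ _ (_ :\: _)) => // /(_ isT) ->.
  case/card_gt0P => b; rewrite !inE => /and3P[bA /eqP eb /eqP hbv].
  have := inZ b bA hbv; rewrite eb yS /= => /andP[_ nh].
  have only x : x \in A -> tl x = y -> hd x \in Z -> x = b.
    move=> xA ex hx; apply: contraNeq nh => nxb; apply/hitsP; exists x.
    by rewrite !inE nxb.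
  have -> : hits tl A y Z by apply/hitsP; exists b; rewrite hbv.
  have -> : hits tl A y (Z :\ v) = false.
    apply/negbTE/hitsP => -[x [xA ex]]; rewrite !inE => /andP[nxv hx].
    by move: nxv; rewrite (only x) // hbv eqxx.
  apply: (@leq_trans #|[set b]|); last by rewrite cards1.
  rewrite add0n subset_leq_card //; apply/subsetP => x.
  by rewrite !inE => /and3P[xA /eqP ex /eqP hx]; rewrite (only x) // hx.
have h2 : \sum_(x in A) enters tl (Z :\ v) x + \sum_(x in A) ((tl x \notin S) && (hd x == v))
      + \sum_(x in A) (x == a)
    <= \sum_(x in A) enters tl Z x + \sum_(x in A) (tl x == v).
  rewrite -!big_split; apply: leq_sum => x xA; rewrite /enters !inE /=.
  have [->|nxa] := eqVneq x a.
    have nhv : hd a != v by apply: contraNneq ha => ->.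
    by rewrite ta eqxx (negPf ha) (negPf nhv) !andbF.
  have [hx|_] /= := eqVneq (hd x) v.
    by rewrite hx vZ; case/andP: (inZ x xA hx) => -> _; case: (tl x \in S).
  rewrite andbF /= addn0; case: (hd x \in Z) => //=.
  by case: (tl x == v); case: (tl x \in Z); case: (tl x \in S).
have h3 : 0 < \sum_(x in A) (x == a) by rewrite (bigD1 a) //= eqxx.
move: pf; rewrite h0 -sum_bool_card.
clear -h1 h2 h3; lia.
Qed.

(** If every [b] fails, each is blocked by a tight set separating [v] from [hd a]. Uncrossing merges
    these into one largest and one smallest blocking set, which, possibly after moving [v] across
    their border, violate a demand. *)
Lemma exists_split V tl A (R : T -> nat) v a :
    network V tl A -> v \in V -> (forall x, x \in A -> hd x = v -> tl x != v) ->
    (forall X x, X \subset V -> x \in X -> x != v -> R x <= cut tl A X) ->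
    a \in A -> tl a = v ->
  exists b, [/\ b \in A, hd b = v &
    forall X x, X \subset V -> x \in X -> x != v ->
      R x <= cut (split_tail tl a b) (A :\ b) X].
Proof.
move=> net vV noloop hR aA ta; have [SV wf pf d2] := net.
have SX X y : X \subset V -> y \in S -> y \notin X.
  by move=> sX yS; apply: contra (SV y yS); apply: (subsetP sX).
have vS : v \notin S by apply: contraL vV; apply: SV.
have nhv : hd a != v by apply/eqP => e; move: (noloop a aA e); rewrite ta eqxx.
have [b|nob] := pickP (fun b => [&& b \in A, hd b == v &
    [forall X : {set T}, (X \subset V) ==> [forall x in X, (x != v) ==>
      (R x <= cut (split_tail tl a b) (A :\ b) X)]]]).
  case/and3P => bA /eqP hb /forallP h; exists b; split => // X x sX xX xv.
  by move/implyP: (h X) => /(_ sX)/forall_inP/(_ x xX)/implyP; apply.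
pose tight X := [exists x in X, (x != v) && (cut tl A X <= R x)].
have tightP X : tight X -> exists x, [/\ x \in X, x != v & cut tl A X <= R x].
  by move=> /exists_inP[x xX /andP[]]; exists x.
(* These are the two obstructions of [cut_split]: an [outer] set would lose the entry [a], an
   [inner] set the entry [b]. *)
pose outer X := [&& X \subset V, tight X, hd a \in X & v \notin X].
pose inner X := [&& X \subset V, tight X, hd a \notin X & v \in X].
have bad b : b \in ins A v ->
    (exists2 X, outer X & origin_in tl A b X) \/ (exists2 X, inner X & ~~ origin_in tl A b X).
  rewrite inE => /andP[bA /eqP hb]; move: (nob b); rewrite bA hb eqxx /=.
  move/negbT/forallPn => [X]; rewrite negb_imply => /andP[sX /forall_inPn[x xX]].
  rewrite negb_imply -ltnNge => /andP[xv lt].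
  have := @cut_split tl A a b X aA bA; rewrite hb => /(_ ta vS nhv (SX X ^~ sX)) => le.
  have leR := hR X x sX xX xv.
  have tX : tight X.
    apply/exists_inP; exists x => //; rewrite xv /=.
    apply: leq_trans le _; rewrite -addn1 in lt; apply: leq_trans lt.
    by rewrite leq_add2l leq_b1.
  have : ([&& v \in X, hd a \notin X & ~~ origin_in tl A b X]
       || [&& v \notin X, hd a \in X & origin_in tl A b X]).
    by apply: contraTT (leq_trans leR le) => /negPf ->; rewrite addn0 -ltnNge.
  by case/orP => /and3P[vX aX o]; [right|left]; exists X => //; apply/and4P.
have sum1 (p : pred Arc) : p a -> 0 < \sum_(x in A) (p x : nat).
  by move=> pa; rewrite (bigD1 a) //= pa.
(* If the demand vertex of one set lies in the other set, submodularity applies. Otherwise the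
   demand vertices lie in the two differences, and [a] makes [cut_uncross] strict, a
   contradiction. *)
have cross X Y : X \subset V -> Y \subset V -> tight X -> tight Y ->
    crossing tl (X :&: Y) (~: (X :|: Y)) a || crossing tl (~: (X :|: Y)) (X :&: Y) a ->
    tight (X :&: Y) /\ tight (X :|: Y).
  move=> sX sY tX tY ca.
  have [x [xX xv lex]] := tightP _ tX; have [y [yY yv ley]] := tightP _ tY.
  have sI : X :&: Y \subset V by apply: subset_trans sX; apply: subsetIl.
  have sU : X :|: Y \subset V by rewrite subUset sX.
  have sub := cut_submodular tl A X Y.
  have [xY|xY] := boolP (x \in Y).
    have xI : x \in X :&: Y by rewrite inE xX.
    have yU : y \in X :|: Y by rewrite inE yY orbT.
    have h1 := hR _ x sI xI xv; have h2 := hR _ y sU yU yv.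
    split; apply/exists_inP; [exists x|exists y]; rewrite // ?xv ?yv /=;
    clear -h1 h2 sub lex ley; lia.
  have [yX|yX] := boolP (y \in X).
    have yI : y \in X :&: Y by rewrite inE yX.
    have xU : x \in X :|: Y by rewrite inE xX.
    have h1 := hR _ y sI yI yv; have h2 := hR _ x sU xU xv.
    split; apply/exists_inP; [exists y|exists x]; rewrite // ?xv ?yv /=;
    clear -h1 h2 sub lex ley; lia.
  have h1 : R x <= cut tl A (X :\: Y).
    by apply: hR xv; [apply: subset_trans sX; apply: subsetDl|rewrite inE xX xY].
  have h2 : R y <= cut tl A (Y :\: X).
    by apply: hR yv; [apply: subset_trans sY; apply: subsetDl|rewrite inE yX yY].
  have h3 := sum1 (fun x => crossing tl (X :&: Y) (~: (X :|: Y)) x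
                            || crossing tl (~: (X :|: Y)) (X :&: Y) x) ca.
  have h4 := cut_uncross Y net sX; rewrite /= in h3 h4.
  by exfalso; clear -h1 h2 h3 h4 lex ley; lia.
have outerU X Y : outer X -> outer Y -> outer (X :|: Y).
  case/and4P => sX tX aX vX /and4P[sY tY aY vY].
  have [|_ tU] := cross X Y sX sY tX tY.
    by rewrite /crossing ta !inE (negPf vX) (negPf vY) vS aX aY orbT.
  by rewrite /outer subUset sX sY tU !inE aX negb_or vX vY.
have innerI X Y : inner X -> inner Y -> inner (X :&: Y).
  case/and4P => sX tX aX vX /and4P[sY tY aY vY].
  have [|tI _] := cross X Y sX sY tX tY.
    by rewrite /crossing ta !inE (negPf aX) (negPf aY) vS vX vY.
  by rewrite /inner (subset_trans (subsetIl X Y) sX) tI !inE (negPf aX) vX vY.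
have {outerU} hP : (exists2 P, outer P & forall X, outer X -> X \subset P)
    \/ forall X, ~~ outer X.
  have [P0 /maxset_exists[P /maxsetP[oP mP] _]|no] := pickP outer; last first.
    by right => X; rewrite no.
  left; exists P => // X oX; rewrite -(mP _ (outerU _ _ oX oP)) ?subsetUl //.
  exact: subsetUr.
have {innerI} hQ : (exists2 Q, inner Q & forall X, inner X -> Q \subset X)
    \/ forall X, ~~ inner X.
  have [Q0 /minset_exists[Q /minsetP[iQ mQ] _]|no] := pickP inner; last first.
    by right => X; rewrite no.
  left; exists Q => // X iX; rewrite -(mQ _ (innerI _ _ iX iQ)) ?subsetIl //.
  exact: subsetIr.
exfalso; case: hP hQ => [[P oP mP]|noP] [[Q iQ mQ]|noQ].
- have [sP tP aP vP] := and4P oP; have [sQ tQ aQ vQ] := and4P iQ.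
  have [p [pP pv lep]] := tightP _ tP; have [q [qQ qv leq]] := tightP _ tQ.
  (* When a demand vertex is common to both sets, [a] runs from [Q :\: P] to [P :\: Q] and makes
     submodularity strict. *)
  have [pQ|pQ] := boolP ((p \in Q) || (q \in P)).
    have sub := cut_submodular tl A Q P.
    have h3 : 0 < \sum_(x in A) crossing tl (Q :\: P) (P :\: Q) x.
      by apply: sum1; rewrite /crossing ta !inE vS vQ vP aQ aP.
    have sI : Q :&: P \subset V by apply: subset_trans sQ; apply: subsetIl.
    have sU : Q :|: P \subset V by rewrite subUset sQ.
    case/orP: pQ => [pQ|qP].
      have h1 : R p <= cut tl A (Q :&: P) by apply: hR => //; rewrite inE pQ.
      have h2 : R q <= cut tl A (Q :|: P) by apply: hR => //; rewrite inE qQ.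
      clear -lep leq h1 h2 h3 sub; lia.
    have h1 : R q <= cut tl A (Q :&: P) by apply: hR => //; rewrite inE qQ.
    have h2 : R p <= cut tl A (Q :|: P) by apply: hR => //; rewrite inE pP orbT.
    clear -lep leq h1 h2 h3 sub; lia.
  (* No arc entering [v] originates in [Q :\: P], since its blocking set either forces the origin
     into [P] or keeps it out of [Q]. So deleting [v] from [Q :\: P] lowers the cut, against
     [cut_uncross]. *)
  move: pQ; rewrite negb_or => /andP[pQ qP].
  have h1 : R p <= cut tl A (P :\: Q).
    by apply: hR (pv); [apply: subset_trans sP; apply: subsetDl|rewrite inE pP pQ].
  have h2 : R q <= cut tl A (Q :\: P :\ v).
    apply: hR (qv); last by rewrite !inE qQ qP qv.
    by apply: subset_trans sQ; apply: subset_trans (subsetDl _ _); apply: subsetDl.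
  have h3 : cut tl A (Q :\: P :\ v) < cut tl A (Q :\: P).
    apply: (@cut_del_vertex tl A (Q :\: P) v a) => //; rewrite ?inE ?vP ?vQ ?(negPf aQ) ?andbF //.
      exact: pf.
    move=> b bv; apply/negP => o; have bA : b \in A by move: bv; rewrite inE => /andP[].
    case/andP: (origin_inD bA (d2 _) (SX Q ^~ sQ) (SX P ^~ sP) o) => oQ oP'.
    case: (bad b bv) => -[X oX]; first by apply/negP; apply: contra oP'; apply/origin_in_sub/mP.
    by move/negP; apply; apply: origin_in_sub oQ; apply: mQ.
  have := cut_uncross Q net sP.
  clear -lep leq h1 h2 h3; lia.
- have [sP tP aP vP] := and4P oP; have [p [pP pv lep]] := tightP _ tP.
  have : R p <= cut tl A (v |: P).
    by apply: hR (pv); [rewrite subUset sub1set vV|rewrite !inE pP orbT].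
  suff : cut tl A (v |: P) < cut tl A P by clear -lep; lia.
  apply: (@cut_add_vertex tl A P v a) => //; first by move=> y; apply: SX.
  move=> b /bad [[X oX]|[X iX]]; last by move: (noQ X); rewrite iX.
  exact/origin_in_sub/mP.
- have [sQ tQ aQ vQ] := and4P iQ; have [q [qQ qv leq]] := tightP _ tQ.
  have : R q <= cut tl A (Q :\ v).
    by apply: hR (qv); [apply: subset_trans sQ; apply: subsetDl|rewrite !inE qQ qv].
  suff : cut tl A (Q :\ v) < cut tl A Q by clear -leq; lia.
  apply: (@cut_del_vertex tl A Q v a) => //; first exact: pf.
  move=> b /bad [[X oX]|[X iX]]; first by move: (noP X); rewrite oX.
  by apply: contra; apply/origin_in_sub/mQ.
- have : 0 < #|ins A v|.
    apply: leq_trans (pf v vV); apply/card_gt0P; exists a.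
    by rewrite !inE aA ta eqxx.
  case/card_gt0P => b /bad [[X oX]|[X iX]]; [move: (noP X)|move: (noQ X)].
    by rewrite oX.
  by rewrite iX.
Qed.

Lemma network_split V tl A a b :
    network V tl A -> hd b \in V -> a \in A -> b \in A -> tl a = hd b ->
    tl b != hd b -> hd a != hd b ->
  network V (split_tail tl a b) (A :\ b).
Proof.
case=> SV wf pf d2 vV aA bA ta tb ha.
(* At [tl b] the arc [a] takes the place of the deleted [b]; no other vertex gains a leaving arc. *)
have outs_le x : x != hd b -> #|outs (split_tail tl a b) (A :\ b) x| <= #|outs tl A x|.
  move=> xv; apply: (@card_le_inj _ _ _ _ (fun e => if e == a then b else e)).
    move=> e e'; rewrite !inE => /andP[/andP[eb _] _] /andP[/andP[e'b _] _].
    have [->|na] := eqVneq e a; have [->|na'] := eqVneq e' a => //= E.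
      by move: e'b; rewrite -E eqxx.
    by move: eb; rewrite E eqxx.
  move=> e; rewrite !inE /split_tail => /andP[/andP[eb eA]].
  by have [_|na] := eqVneq e a; rewrite ?bA ?eA.
split=> // [x|x xV|y yS].
- rewrite !inE /split_tail => /andP[_ xA]; have [h1 h2] := wf x xA.
  by split => //; case: eqP => // _; case: (wf b bA).
- have [->|xv] := eqVneq x (hd b).
    have le := pf _ vV.
    have -> : ins (A :\ b) (hd b) = ins A (hd b) :\ b.
      by apply/setP => e; rewrite !inE andbA.
    have : outs (split_tail tl a b) (A :\ b) (hd b) \subset outs tl A (hd b) :\ a.
      apply/subsetP => e; rewrite !inE /split_tail => /andP[/andP[eb eA]].
      by have [->|na] := eqVneq e a; [rewrite (negPf tb)|rewrite eA].
    move/subset_leq_card => h; move: le h.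
    rewrite (cardsD1 a (outs tl A _)) (cardsD1 b (ins A _)).
    by rewrite !inE aA bA ta !eqxx /=; clear; lia.
  apply: leq_trans (outs_le x xv) _; apply: leq_trans (pf x xV) _.
  apply/subset_leq_card/subsetP => e; rewrite !inE => /andP[eA /eqP he].
  by rewrite he eA eqxx !andbT; apply: contraNneq xv => <-; rewrite he.
- apply: leq_trans (outs_le y _) (d2 y yS).
  by apply: contraTneq vV => <-; apply: SV.
Qed.

Definition bypass tl v (g : Arc -> Arc) := fun a => if tl a == v then tl (g a) else tl a.

Lemma complete_split V tl A (R : T -> nat) v :
    network V tl A -> v \in V -> (forall x, x \in A -> hd x = v -> tl x != v) ->
    (forall X x, X \subset V -> x \in X -> x != v -> R x <= cut tl A X) ->
  exists g, [/\ forall a, a \in A -> tl a = v -> g a \in A /\ hd (g a) = v,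
    {in outs tl A v &, injective g}
    & forall X x, X \subset V :\ v -> x \in X ->
      R x <= cut (bypass tl v g) [set a in A | hd a != v] X].
Proof.
have [n] := ubnP #|outs tl A v|; elim: n => // n IH in tl A *.
move=> len net vV noloop hR.
have [a|none] := pickP (mem (outs tl A v)); last first.
  have no a : a \in A -> tl a = v -> False.
    by move=> aA ta; move: (none a); rewrite !inE aA ta eqxx.
  exists id; split => [a aA /(no a aA)//|a|X x sX xX].
    by rewrite !inE => ? /andP[aA /eqP /(no a aA)].
  have vX : v \notin X by apply: contraL isT => /(subsetP sX); rewrite !inE eqxx.
  rewrite (@eq_cut tl A).
  - apply: hR => //; first by apply: subset_trans sX (subsetDl _ _).
    by apply: contraNneq vX => <-.
  - move=> a hX; rewrite inE (_ : hd a != v) ?andbT //.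
    by apply: contraNneq vX => <-.
  - by move=> a _ _; rewrite /bypass; case: eqP.
rewrite !inE => /andP[aA /eqP ta].
have [b [bA hb hb']] := exists_split net vV noloop hR aA ta.
have tb := noloop b bA hb.
have ha : hd a != v by apply/eqP => e; move: (noloop a aA e); rewrite ta eqxx.
have nab : a != b by apply: contraNneq ha => ->; rewrite hb.
have net' : network V (split_tail tl a b) (A :\ b).
  by apply: network_split; rewrite ?hb.
have tx x : x != a -> split_tail tl a b x = tl x by rewrite /split_tail => /negPf ->.
have ta' : split_tail tl a b a = tl b by rewrite /split_tail eqxx.
have [] := IH _ _ _ net' vV _ hb'.
- rewrite ltnS in len; apply: leq_trans len.
  rewrite (cardsD1 a (outs tl A v)) !inE aA ta eqxx /= add1n ltnS.
  apply/subset_leq_card/subsetP => x; rewrite !inE => /andP[/andP[_ xA]].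
  have [->|xa] := eqVneq x a; first by rewrite ta' (negPf tb).
  by rewrite tx // xA.
- move=> x; rewrite !inE => /andP[_ xA] hx; rewrite tx; first exact: noloop.
  by apply: contraNneq ha => <-; rewrite hx.
move=> g [gP ginj gR].
have gP' x : x \in A -> x != a -> tl x = v -> [/\ g x != b, g x \in A & hd (g x) = v].
  move=> xA xa txv; have xb : x != b by apply: contraNneq tb => <-; rewrite txv.
  have [] := gP x; rewrite ?inE ?xA ?xb ?tx //.
  by case/andP => h1 h2 h3; rewrite h1 h2.
have xin x : x \in outs tl A v -> x != a ->
    x \in outs (split_tail tl a b) (A :\ b) v.
  rewrite !inE => /andP[xA /eqP txv] xa; rewrite tx // txv xA eqxx !andbT.
  by apply: contraNneq tb => <-; rewrite txv.
(* Injectivity holds because [g] was chosen after the deletion of [b], so it does not use [b] on the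
   arcs leaving [v]. *)
exists (fun x => if x == a then b else g x); split.
- move=> x xA txv; have [_|xa] := eqVneq x a; first by [].
  by have [] := gP' x xA xa txv.
- move=> x y xo yo; move: (xo) (yo); rewrite !inE => /andP[xA /eqP txv] /andP[yA /eqP tyv].
  have [->|xa] := eqVneq x a; have [->|ya] := eqVneq y a => // E.
  + by have [] := gP' y yA ya tyv; rewrite -E eqxx.
  + by have [] := gP' x xA xa txv; rewrite E eqxx.
  + by apply: ginj E; apply: xin.
- move=> X x sX xX; apply: leq_trans (gR X x sX xX) _.
  have vX : v \notin X by apply: contraL isT => /(subsetP sX); rewrite !inE eqxx.
  apply: eq_leq; apply: eq_cut => e hX.
    rewrite !inE; case: (eqVneq e b) => // eb.
    by rewrite eb hb eqxx !andbF.
  rewrite !inE => /andP[eA _]; rewrite /bypass.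
  have [->|ea] := eqVneq e a; first by rewrite ta' (negPf tb) ta eqxx.
  rewrite tx //; case: eqP => // te; rewrite tx //.
  have [_ _ h] := gP' e eA ea te.
  by apply: contraNneq ha => <-; rewrite h.
Qed.

Lemma network_bypass V tl A v g :
    network V tl A -> v \in V -> (forall x, x \in A -> hd x = v -> tl x != v) ->
    (forall a, a \in A -> tl a = v -> g a \in A /\ hd (g a) = v) ->
    {in outs tl A v &, injective g} ->
  network (V :\ v) (bypass tl v g) [set a in A | hd a != v].
Proof.
case=> SV wf pf d2 vV noloop gP ginj.
have tne a : a \in A -> bypass tl v g a != v.
  move=> aA; rewrite /bypass; have [ta|//] := eqVneq (tl a) v.
  by have [h1 h2] := gP a aA ta; apply: noloop.
have outs_le x : x != v ->
    #|outs (bypass tl v g) [set a in A | hd a != v] x| <= #|outs tl A x|.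
  move=> xv; apply: (@card_le_inj _ _ _ _ (fun e => if tl e == v then g e else e)).
    move=> e e'; rewrite !inE => /andP[/andP[eA he] _] /andP[/andP[e'A he'] _].
    have [te|te] := eqVneq (tl e) v; have [te'|te'] := eqVneq (tl e') v => // E.
    - by apply: ginj; rewrite // inE ?eA ?e'A ?te ?te' eqxx.
    - by move: he'; rewrite -E; case: (gP e eA te) => _ ->; rewrite eqxx.
    - by move: he; rewrite E; case: (gP e' e'A te') => _ ->; rewrite eqxx.
  move=> e; rewrite !inE /bypass => /andP[/andP[eA he]].
  by have [te|te] := eqVneq (tl e) v; rewrite ?eA //; case: (gP e eA te) => ->.
split.
- by move=> y yS; rewrite !inE negb_and (SV y yS) orbT.
- move=> a; rewrite !inE => /andP[aA ha]; have [h1 h2] := wf a aA; rewrite ha h1.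
  split => //; rewrite (tne a aA) /= /bypass; have [ta|//] := eqVneq (tl a) v.
  by have [/wf[]] := gP a aA ta.
- move=> x; rewrite !inE => /andP[xv xV]; apply: leq_trans (outs_le x xv) _.
  apply: leq_trans (pf x xV) _.
  apply/subset_leq_card/subsetP => e; rewrite !inE => /andP[eA /eqP he].
  by rewrite he eA eqxx xv.
- move=> y yS; apply: leq_trans (outs_le y _) (d2 y yS).
  by apply: contraTneq vV => <-; apply: SV.
Qed.

(** * Lifting and extending packings *)

Definition arb tl y (F : {set Arc}) :=
  [/\ {in F &, injective hd},
      forall a, a \in F -> tl a = y \/ tl a \in hd @: F
    & exists2 r : T -> nat, r y = 0 & forall a, a \in F -> r (tl a) < r (hd a)].

Definition packing tl A (F : T -> {set Arc}) :=
  forall y, y \in S -> [/\ F y \subset A, arb tl y (F y)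
    & forall y', y' \in S -> y' != y -> [disjoint F y & F y']].

Definition covering (F : T -> {set Arc}) v := [set y in S | v \in hd @: F y].

(** Terminals are never heads of arcs, so an arc leaving one can only belong to the arborescence
    rooted there. *)
Lemma packing_terminal V tl A F y y' a : network V tl A -> packing tl A F ->
  y \in S -> y' \in S -> a \in F y' -> tl a = y -> y' = y.
Proof.
case=> SV wf _ _ pk yS y'S aF ta; have [sF [_ hF _] _] := pk y' y'S.
case: (hF a aF) => [<-//|]; rewrite ta => /imsetP[b bF e].
by have [] := wf b (subsetP sF b bF); rewrite -e (negPf (SV y yS)).
Qed.

(** Back in the original network the rerouted arcs of [F] start at [v], so an arc entering [v] is
    added. It leaves [y] or is [g a] for some [a] in [F], which will keep lifted arborescences
    disjoint. *)
Lemma lift_arb tl v g y (F : {set Arc}) A :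
    y != v -> (forall x, x \in A -> hd x = v -> tl x != v) ->
    (forall a, a \in F -> hd a != v) ->
    (forall a, a \in F -> tl a = v -> g a \in A /\ hd (g a) = v) ->
    arb (bypass tl v g) y F ->
  exists E : {set Arc}, [/\ arb tl y (F :|: E),
    forall e, e \in E -> [/\ e \in A, hd e = v
      & tl e = y \/ exists2 a, a \in F & tl a = v /\ e = g a]
    & forall e, e \in E -> hits tl A y [set v] -> tl e = y].
Proof.
move=> yv noloop hF gP [inj hp [r ry hr]].
have [a0 /andP[a0F /eqP ta0]|none] := pickP (fun a => (a \in F) && (tl a == v)); last first.
  have tE a : a \in F -> bypass tl v g a = tl a.
    by move=> aF; rewrite /bypass; move: (none a); rewrite aF /= => ->.
  exists set0; rewrite setU0; split => [|e|e]; rewrite ?inE //.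
  split => // [a aF|]; first by rewrite -tE //; apply: hp.
  by exists r => // a aF; rewrite -tE //; apply: hr.
suff [b [bA [hb hb1 hb2 hb3 hb4]]] : exists b, b \in A /\ [/\ hd b = v,
    tl b = y \/ tl b \in hd @: F,
    tl b = y \/ (exists2 a, a \in F & tl a = v /\ b = g a),
    hits tl A y [set v] -> tl b = y
    & forall a, a \in F -> tl a = v -> r (tl b) <= r (bypass tl v g a)].
  have tb := noloop b bA hb.
  exists [set b]; split; last 1 first.
  - by move=> e /set1P ->.
  - split.
    + move=> e e'; rewrite !inE => /orP[eF|/eqP ->] /orP[e'F|/eqP ->] //; first exact: inj.
        by move=> E; move: (hF e eF); rewrite E hb eqxx.
      by move=> E; move: (hF e' e'F); rewrite -E hb eqxx.
    + move=> a; rewrite !inE => /orP[aF|/eqP ->].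
        have [ta|ta] := eqVneq (tl a) v.
          by right; apply/imsetP; exists b; rewrite ?inE ?eqxx ?orbT ?ta.
        case: (hp a aF); rewrite /bypass (negPf ta); first by left.
        by move=> h; right; apply: (subsetP (imsetS hd (subsetUl F [set b]))).
      case: hb1 => [->|h]; [by left|right].
      exact: (subsetP (imsetS hd (subsetUl F [set b]))).
    (* Doubling the ranks makes room for [v] above [tl b] and below the heads of the arcs of [F]
       leaving [v]. *)
    + exists (fun x => if x == v then (r (tl b)).*2.+1 else (r x).*2).
        by rewrite (negPf yv) ry.
      move=> a; rewrite !inE => /orP[aF|/eqP ->]; last first.
        by rewrite hb eqxx (negPf tb).
      rewrite (negPf (hF a aF)); have := hr a aF; rewrite /bypass.
      have [ta|ta] := eqVneq (tl a) v; last by rewrite ltn_double.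
      by move: (hb4 a aF ta); rewrite /bypass ta eqxx; clear; lia.
  - by move=> e /set1P ->.
(* An arc from [y], whose rank is 0, is preferred. Otherwise the candidate [g a] with tail of least
   rank is taken, so that no cycle through [v] arises. *)
have [hy|hy] := boolP (hits tl A y [set v]).
  have [b [bA tb /set1P hb]] := hitsP _ _ _ _ hy.
  by exists b; split => //; split; rewrite ?tb ?ry //; left.
pose p a := (a \in F) && (tl a == v).
have pa0 : p a0 by rewrite /p a0F ta0 eqxx.
case: (@arg_minnP _ a0 p (fun a => r (bypass tl v g a)) pa0) => a /andP[aF /eqP ta] amin.
have [gA gh] := gP a aF ta.
have eg : bypass tl v g a = tl (g a) by rewrite /bypass ta eqxx.
exists (g a); split => //; split => //.
- by rewrite -eg; apply: hp.
- by right; exists a.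
- by move=> a' a'F ta'; rewrite -eg; apply: amin; rewrite /p a'F ta' eqxx.
Qed.

(* Among the arcs entering [v], the ones leaving terminals are used first: then
   every used arc from a vertex is charged to a terminal not adjacent to [v]. *)
Definition prefers_terminals tl A v (F : T -> {set Arc}) :=
  forall y a, y \in S -> a \in F y -> hd a = v -> hits tl A y [set v] -> tl a = y.

Lemma arb_add tl y (F : {set Arc}) b :
    arb tl y F -> hd b \notin hd @: F -> tl b != hd b -> y != hd b ->
    tl b = y \/ tl b \in hd @: F ->
  arb tl y (b |: F).
Proof.
move=> [inj hp [r ry hr]] hb tb yb hb'.
have sub : hd @: F \subset hd @: (b |: F) by apply/imsetS/subsetUr.
have hne a : a \in F -> hd a != hd b.
  by move=> aF; apply: contraNneq hb => <-; apply: imset_f.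
have tne a : a \in F -> tl a != hd b.
  move=> aF; case: (hp a aF) => [->//|h]; by apply: contraNneq hb => <-.
split.
- move=> e e'; rewrite !inE => /orP[/eqP ->|eF] /orP[/eqP ->|e'F] //; last exact: inj.
    by move=> E; move: (hne _ e'F); rewrite E eqxx.
  by move=> E; move: (hne _ eF); rewrite E eqxx.
- move=> a; rewrite !inE => /orP[/eqP ->|aF].
    by case: hb' => [|h]; [left|right; apply: (subsetP sub)].
  by case: (hp a aF) => [|h]; [left|right; apply: (subsetP sub)].
- exists (fun x => if x == hd b then (r (tl b)).+1 else r x); first by rewrite (negPf yb).
  move=> a; rewrite !inE => /orP[/eqP ->|aF]; first by rewrite eqxx (negPf tb).
  by rewrite (negPf (hne a aF)) (negPf (tne a aF)); apply: hr.
Qed.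

Lemma extendable V tl A v F (R : T -> nat) :
    network V tl A -> v \in V -> (forall x, x \in A -> hd x = v -> tl x != v) ->
    packing tl A F -> prefers_terminals tl A v F ->
    (forall x, x \in V -> x != v -> R x <= #|covering F x|) ->
    (forall x, x \in V -> R v <= R x) -> R v <= cut tl A [set v] ->
    #|covering F v| < R v ->
  exists y b, [/\ y \in S, b \in ins A v, v \notin hd @: F y
    & forall y', y' \in S -> b \notin F y']
    /\ (tl b = y \/ tl b \in hd @: F y) /\ (hits tl A y [set v] -> tl b = y).
Proof.
move=> net vV noloop pk pref hF Rmin Rcut lt; have [SV wf pf d2] := net.
have vS : v \notin S by apply: contraL vV; apply: SV.
have [y /and3P[yS hy vy]|none] :=
    pickP (fun y => [&& y \in S, hits tl A y [set v] & v \notin hd @: F y]).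
  have [b [bA tb /set1P hb]] := hitsP _ _ _ _ hy.
  exists y, b; split; last by rewrite tb; split; [left|].
  split; rewrite ?inE ?bA ?hb ?eqxx // => y' y'S; apply/negP => bF.
  have e := packing_terminal net pk yS y'S bF tb.
  by rewrite e in bF; move: vy; rewrite -hb imset_f.
have adj y : y \in S -> hits tl A y [set v] -> v \in hd @: F y.
  by move=> yS hy; move: (none y); rewrite yS hy /=; case: (v \in _).
pose inner := [set b in A | enters tl [set v] b].
pose used := [set b in inner | [exists y in S, b \in F y]].
(* Coverage of [v] is the number of adjacent terminals plus [#|far|], and its cut is the same number
   plus [#|inner|]. By [pref], used arcs are charged injectively to [far]. *)
have lt1 : #|used| < #|inner|.
  pose far := [set y in covering F v | ~~ hits tl A y [set v]].
  have cE : #|covering F v| = \sum_(y in S) hits tl A y [set v] + #|far|.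
    rewrite sum_bool_card -(cardsID [set y | hits tl A y [set v]] (covering F v)).
    congr (_ + _); apply: eq_card => y; rewrite !inE; last by rewrite andbC.
    by case yS: (y \in S) => //=; case hy: (hits _ _ _ _); rewrite ?andbF ?andbT ?adj.
  have : #|used| <= #|far|.
    rewrite -(card_imset _ (@Some_inj _)).
    apply: leq_trans (leq_imset_card (fun y => [pick b in F y | hd b == v]) (mem far)).
    apply/subset_leq_card/subsetP => _ /imsetP[b bu ->]; move: bu.
    rewrite !inE => /andP[/andP[bA /and3P[/set1P hb]]]; rewrite !inE => tbv tbS.
    case/exists_inP => y yS bF; apply/imsetP; exists y.
      have vF : v \in hd @: F y by rewrite -hb imset_f.
      rewrite !inE yS vF; apply/negP => hy.
      by move: tbS; rewrite (pref y b yS bF hb hy) yS.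
    case: pickP => [b' /andP[b'F /eqP hb']|/(_ b)]; last by rewrite bF hb eqxx.
    have [_ [inj _ _] _] := pk y yS.
    by congr Some; apply: inj; rewrite ?hb ?hb'.
  move: (leq_trans lt Rcut); rewrite cE /cut !sum_bool_card -/inner.
  by clear; lia.
have [b bi bu] : exists2 b, b \in inner & b \notin used.
  apply/subsetPn; apply/negP => /subset_leq_card; by rewrite leqNgt lt1.
move: (bi); rewrite !inE => /andP[bA /and3P[/set1P hb tbv tbS]].
have zV : tl b \in V by have [_] := wf b bA; rewrite (negPf tbS) orbF.
have zv := noloop b bA hb.
have : ~~ (covering F (tl b) \subset covering F v).
  apply/negP => /subset_leq_card; rewrite leqNgt; apply/negP; rewrite negbK.
  apply: leq_trans lt _; apply: leq_trans (Rmin _ zV) _; exact: hF.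
case/subsetPn => y; rewrite !inE => /andP[yS zy]; rewrite yS /= => vy.
exists y, b; split; last first.
  by split; [right|move=> hy; rewrite (adj y yS hy) in vy].
split; rewrite ?inE ?bA ?hb ?eqxx // => y' y'S.
apply: contra bu => bF; rewrite inE bi; apply/exists_inP; by exists y'.
Qed.

Lemma extend_packing V tl A v F (R : T -> nat) :
    network V tl A -> v \in V -> (forall x, x \in A -> hd x = v -> tl x != v) ->
    packing tl A F -> prefers_terminals tl A v F ->
    (forall x, x \in V -> x != v -> R x <= #|covering F x|) ->
    (forall x, x \in V -> R v <= R x) -> R v <= cut tl A [set v] ->
  exists2 F', packing tl A F' & forall x, x \in V -> R x <= #|covering F' x|.
Proof.
move=> net vV noloop + + + Rmin Rcut; have [SV wf pf d2] := net.
have [n] := ubnP (R v - #|covering F v|); elim: n => // n IH in F * => len pk pref hF.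
have [le|lt] := leqP (R v) #|covering F v|.
  exists F => // x xV; have [->//|xv] := eqVneq x v; exact: hF.
have [y [b [[yS bv vy unused] [tb hyb]]]] :=
  extendable net vV noloop pk pref hF Rmin Rcut lt.
move: bv; rewrite inE => /andP[bA /eqP hb].
pose F' y' := if y' == y then b |: F y else F y'.
have subF y' : F y' \subset F' y'.
  by rewrite /F'; case: eqP => // ->; apply: subsetUr.
have cov x : covering F x \subset covering F' x.
  apply/subsetP => y'; rewrite !inE => /andP[->] /=.
  exact/subsetP/imsetS/subF.
apply: (IH F').
- have : #|covering F v| < #|covering F' v|; last by move: len lt; clear; lia.
  apply: proper_card; rewrite properE cov; apply/subsetPn; exists y.
    by rewrite !inE yS /F' eqxx -hb imset_f // !inE eqxx.
  by rewrite inE yS.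
- have yv : y != v by apply: contraTneq vV => <-; apply: SV.
  have tbv := noloop b bA hb.
  move=> y' y'S; have [sF aF dF] := pk y' y'S; split.
  + rewrite /F'; case: eqP => [e|//]; rewrite subUset sub1set bA -e.
    by [].
  + rewrite /F'; case: eqP => [e|//]; rewrite e in aF.
    by rewrite e; apply: arb_add; rewrite ?hb.
  + move=> y2 y2S y2y'; rewrite /F'; case: (eqVneq y' y) => [e|ny'].
      rewrite -e (negPf y2y') disjoint_sym -setI_eq0 setIUr setU_eq0 !setI_eq0.
      rewrite -[[disjoint F y2 & F y']]disjoint_sym dF // andbT.
      by rewrite disjoint_sym disjoints1 unused.
    case: (eqVneq y2 y) => [e|ny]; last exact: dF.
    rewrite -setI_eq0 setIUr setU_eq0 !setI_eq0 -e dF // andbT.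
    by rewrite disjoint_sym disjoints1 unused.
- move=> y' a y'S; rewrite /F'; case: eqP => [->|_]; last exact: pref.
  by rewrite !inE => /orP[/eqP ->//|aF]; apply: pref.
- move=> x xV xv; apply: leq_trans (hF x xV xv) _; exact/subset_leq_card.
Qed.

Theorem exists_packing V tl A (R : T -> nat) :
    network V tl A ->
    (forall X x, X \subset V -> x \in X -> R x <= cut tl A X) ->
  exists2 F, packing tl A F & forall x, x \in V -> R x <= #|covering F x|.
Proof.
have [n] := ubnP #|V|; elim: n => // n IH in V tl A *.
move=> len net0 hR0.
have [v0 v0V|none] := pickP (mem V); last first.
  exists (fun=> set0) => [y yS|x xV]; last by move: (none x); rewrite /= xV.
  split=> [|| y' _ _]; rewrite ?sub0set ?disjoints_subset ?sub0set //.
  by split => [a|a|]; rewrite ?inE //; exists (fun=> 0) => // a; rewrite inE.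
case: (@arg_minnP _ v0 (mem V) R v0V) => v /= vV Rmin.
(* Loops at [v] are discarded: they enter no set and count equally in both degrees of [v]. *)
pose B := [set a in A | (hd a != v) || (tl a != v)].
have noloop x : x \in B -> hd x = v -> tl x != v.
  by rewrite !inE => /andP[_] + hx; rewrite hx eqxx.
have sBA : B \subset A by apply/subsetP => a; rewrite inE => /andP[].
have [SV wf pf d2] := net0.
have vS : v \notin S by apply: contraL vV; apply: SV.
have net : network V tl B.
  split => // [a /(subsetP sBA)/wf//|x xV|y yS]; last first.
    apply: leq_trans (d2 y yS); apply/subset_leq_card/subsetP => a.
    by rewrite !inE => /andP[/andP[->]].
  have [xv|xv] := eqVneq x v.
    have := pf x xV; rewrite xv.
    rewrite -(cardsID [set a | (hd a == v) && (tl a == v)] (outs tl A v)).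
    rewrite -(cardsID [set a | (hd a == v) && (tl a == v)] (ins A v)).
    have -> : outs tl A v :&: [set a | (hd a == v) && (tl a == v)]
            = ins A v :&: [set a | (hd a == v) && (tl a == v)].
      by apply/setP => a; rewrite !inE; case: (hd a == v); case: (tl a == v); rewrite ?andbF.
    rewrite leq_add2l; set o := #|_ :\: _|; set i := #|_ :\: _|.
    have -> : #|outs tl B v| = o.
      by apply: eq_card => a; rewrite !inE; case: (a \in A); case: (hd a == v); case: (tl a == v).
    have -> // : #|ins B v| = i.
    by apply: eq_card => a; rewrite !inE; case: (a \in A); case: (hd a == v); case: (tl a == v).
  apply: leq_trans (_ : _ <= #|outs tl A x|) _.
    by apply/subset_leq_card/subsetP => a; rewrite !inE => /andP[/andP[->]].
  apply: leq_trans (pf x xV) _; apply/subset_leq_card/subsetP => a.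
  by rewrite !inE => /andP[-> /eqP ->]; rewrite xv eqxx.
have cutB X : cut tl A X <= cut tl B X.
  apply: leq_add; last first.
    rewrite !sum_bool_card; apply/subset_leq_card/subsetP => a.
    rewrite !inE => /andP[aA] /and3P[h1 h2 h3]; rewrite aA /enters h1 h2 h3 !andbT /=.
    by apply: contraNT h2; rewrite negb_or !negbK => /andP[/eqP e /eqP ->]; rewrite -e.
  apply: leq_sum => y yS; case: (hitsP tl A) => // -[a [aA ta ha]].
  suff -> : hits tl B y X by [].
  apply/hitsP; exists a; split; rewrite // !inE aA ta.
  by rewrite (_ : y != v) ?orbT //; apply: contraNneq vS => <-.
have hR X x : X \subset V -> x \in X -> R x <= cut tl B X.
  by move=> sX xX; apply: leq_trans (cutB X); apply: hR0.
have [g [gP ginj gR]] :=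
  complete_split net vV noloop (fun X x sX xX _ => hR X x sX xX).
have net' := network_bypass net vV noloop gP ginj.
have [|F' pk' hF'] := IH _ _ _ _ net' gR.
  by rewrite ltnS in len; apply: leq_trans len; rewrite (cardsD1 v V) vV.
have sF' y a : y \in S -> a \in F' y -> a \in B /\ hd a != v.
  by move=> yS aF; have [sF _ _] := pk' y yS; move: (subsetP sF a aF); rewrite inE => /andP.
have /fin_all_exists[E hE] : forall y, exists E : {set Arc}, y \in S ->
  [/\ arb tl y (F' y :|: E), forall e, e \in E -> [/\ e \in B, hd e = v
      & tl e = y \/ exists2 a, a \in F' y & tl a = v /\ e = g a]
    & forall e, e \in E -> hits tl B y [set v] -> tl e = y].
  move=> y; have [yS|yS] := boolP (y \in S); last by exists set0.
  have [sF aF _] := pk' y yS.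
  have [] := @lift_arb tl v g y (F' y) B _ noloop _ _ aF.
  - by apply: contraNneq vS => <-.
  - by move=> a /(sF' _ _ yS)[].
  - by move=> a /(sF' _ _ yS)[aB _]; apply: gP.
  by move=> E hE; exists E.
pose F y := F' y :|: E y.
have same y y' a : y \in S -> y' \in S -> a \in F' y -> a \in F' y' -> y' = y.
  move=> yS y'S h h'; apply/eqP; apply: contraLR h => ne; have [_ _ dF] := pk' y' y'S.
  by rewrite eq_sym in ne; rewrite (disjointFr (dF y yS ne) h').
(* A common arc entering [v] leaves a terminal, which determines the arborescence, or is [g x] for a
   single [x], which lies in only one of them. *)
have disj y y' a : y \in S -> y' \in S -> a \in F y -> a \in F y' -> y' = y.
  move=> yS y'S; have [_ eE _] := hE y yS; have [_ eE' _] := hE y' y'S.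
  rewrite !inE => /orP[h|h] /orP[h'|h']; first exact: same h h'.
  - by have [_] := sF' _ _ yS h; have [_ -> _] := eE' _ h'; rewrite eqxx.
  - by have [_] := sF' _ _ y'S h'; have [_ -> _] := eE _ h; rewrite eqxx.
  - have [_ _ c1] := eE _ h; have [_ _ c2] := eE' _ h'.
    have inO x y0 : y0 \in S -> x \in F' y0 -> tl x = v -> x \in outs tl B v.
      by move=> y0S xF tx; rewrite inE tx eqxx andbT; case: (sF' _ _ y0S xF).
    case: c1 c2 => [ty|[x xF [tx ex]]] [ty'|[x' x'F [tx' ex']]].
    + by rewrite -ty -ty'.
    + apply: (packing_terminal net' pk' yS y'S x'F).
      by rewrite /bypass tx' eqxx -ex'.
    + apply/esym; apply: (packing_terminal net' pk' y'S yS xF).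
      by rewrite /bypass tx eqxx -ex.
    + apply: (same _ _ x) => //; suff -> : x = x' by [].
      apply: ginj; [exact: (inO x y)|exact: (inO x' y')|by rewrite -ex -ex'].
have pk : packing tl B F.
  move=> y yS; have [aE eE _] := hE y yS; split => //.
    rewrite subUset; apply/andP; split; apply/subsetP => a.
      by case/(sF' _ _ yS).
    by case/eE.
  move=> y' y'S ne; rewrite disjoint_subset; apply/subsetP => a aF.
  by rewrite inE; apply: contraNN ne => aF'; rewrite (disj y y' a).
have [|||F2 pk2 hF2] := @extend_packing V tl B v F R net vV noloop pk _ _ Rmin.
- move=> y a yS; rewrite inE => /orP[/(sF' _ _ yS)[_ +] hv|aE _ hy]; first by rewrite hv eqxx.
  by have [_ _ ] := hE y yS; apply.
- move=> x xV xv; apply: leq_trans (hF' x _) _; first by rewrite !inE xv.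
  apply/subset_leq_card/subsetP => y; rewrite !inE => /andP[->] /=.
  exact/subsetP/imsetS/subsetUl.
- by apply: hR; rewrite ?sub1set ?inE.
exists F2 => // y yS; have [sF aF dF] := pk2 y yS; split => //.
exact: subset_trans sF sBA.
Qed.
End Terminals.

(** * Matchings, counting and minima over finite sets *)

Lemma nested_matching (I : finType) (tau : I -> nat) (O D : {set I}) :
    (forall i, #|[set a in O | tau a <= i]| <= #|[set a in D | tau a <= i]|) ->
  exists2 p : I -> I, {in O &, injective p}
    & forall a, a \in O -> p a \in D /\ tau (p a) <= tau a.
Proof.
have [n] := ubnP #|O|; elim: n => // n IH in O * => len hall.
have [o0 o0O|none] := pickP (mem O); last first.
  by exists id => [a b|a] aO; move: (none a); rewrite /= aO.
(* The latest element [o] is matched last: the others occupy at most [#|O| - 1] elements, while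
   [hall] at [tau o] provides at least [#|O|]. *)
case: (@arg_maxnP _ o0 (mem O) tau o0O) => o /= oO omax.
have [||p pinj hp] := IH (O :\ o).
- by rewrite (cardsD1 o) oO in len.
- move=> i; apply: leq_trans (hall i); apply/subset_leq_card/subsetP => a.
  by rewrite !inE => /andP[/andP[_ ->]].
have : ~~ ([set d in D | tau d <= tau o] \subset p @: (O :\ o)).
  apply/negP => /subset_leq_card; rewrite leqNgt => /negP; apply.
  apply: leq_ltn_trans (leq_imset_card _ _) _.
  apply: (@leq_trans #|O|); first by rewrite [in leqRHS](cardsD1 o) oO.
  apply: leq_trans (hall (tau o)); apply/subset_leq_card/subsetP => a aO.
  by rewrite inE aO omax.
case/subsetPn => d; rewrite inE => /andP[dD dle] dnew.
exists (fun a => if a == o then d else p a) => [a b|a] aO.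
  move=> bO; have [->|ao] := eqVneq a o; have [->|bo] := eqVneq b o => // E.
  - by case/negP: dnew; rewrite E imset_f // !inE bo.
  - by case/negP: dnew; rewrite -E imset_f // !inE ao.
  - by apply: pinj; rewrite // !inE ?ao ?bo.
have [->//|ao] := eqVneq a o.
by apply: hp; rewrite !inE ao.
Qed.

(** The easy half of Menger's theorem, to be applied with [Q] a set of arcs that every path must
    use. *)
Lemma size_disjoint_lists (I : finType) (Q : {set I}) (ps : seq (seq I)) :
    pairwise (fun p q => ~~ has (fun a => a \in q) p) ps ->
    (forall p, p \in ps -> exists2 a, a \in p & a \in Q) ->
  size ps <= #|Q|.
Proof.
elim: ps Q => //= p ps IH Q /andP[/allP dp dps] hQ.
have [a ap aQ] := hQ p (mem_head _ _).
rewrite (cardsD1 a) aQ add1n ltnS; apply: IH => // q qps.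
have [|b bq bQ] := hQ q; first by rewrite inE qps orbT.
exists b => //; rewrite !inE bQ andbT; apply: contraTneq (dp q qps) => ba.
by rewrite negbK; apply/hasP; exists a; rewrite // -ba.
Qed.

(** This supplies demands that satisfy the cut condition by construction; the attaining sets turn
    coverage back into cut values. *)
Lemma exists_minimum (I : finType) (V : {set I}) (f : {set I} -> nat) :
  exists R : I -> nat, (forall (X : {set I}) x, X \subset V -> x \in X -> R x <= f X)
    /\ (forall x, x \in V -> exists X : {set I}, [/\ X \subset V, x \in X & R x = f X]).
Proof.
pose P x := [pred X : {set I} | (X \subset V) && (x \in X)].
have minP x : x \in V -> exists2 Y, P x Y & forall X, P x X -> f Y <= f X.
  move=> xV; have PV : P x V by rewrite /= subxx xV.
  by case: (arg_minnP f PV) => Y; exists Y.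
have /fin_all_exists[R hR] : forall x, exists k, x \in V ->
    (forall X, P x X -> k <= f X) /\ (exists2 X, P x X & k = f X).
  move=> x; have [/minP[Y PY minY]|//] := boolP (x \in V); last by exists 0.
  by exists (f Y) => _; split => //; exists Y.
exists R; split => [X x sX xX|x /hR[_ [X /andP[]]]]; last by exists X.
by have [+ _] := hR x (subsetP sX x xX); apply; rewrite /= sX.
Qed.

(** * Temporal networks *)

Section Temporal.
Variables (T Arc : finType) (tail head : Arc -> T) (s : T) (tau : Arc -> nat).

Definition boundary (W : {set T}) := [set a | (head a \in W) && (tail a \notin W)].

Definition inside (W : {set T}) := [set a | (tail a \in W) && (head a \in W)].
Definition leaving (W : {set T}) := [set a | (tail a \in W) && (head a \notin W)].

(** Rooted at an arc, not a vertex, because the tail of [e] lies outside the region under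
    consideration. The rank, waived for [e], excludes cycles. *)
Definition branching (e : Arc) (H : {set Arc}) :=
  [/\ e \in H, {in H &, injective head},
      forall a, a \in H -> a != e ->
        exists2 b, b \in H & head b = tail a /\ tau b <= tau a
    & exists r : T -> nat, forall a, a \in H -> a != e -> r (tail a) < r (head a)].

Definition reaching (B : {set Arc}) (G : Arc -> {set Arc}) v :=
  [set e in B | v \in head @: G e].

Definition path_family (v : T) (ps : seq (seq Arc)) :=
  all (fun p => is_path tail head s p v && tau_respecting tau p) ps
  /\ pairwise (fun p q => ~~ has (fun a => a \in q) p) ps.

Lemma walk_enters (X : {set T}) x p y :
    is_walk tail head x p y -> x \notin X -> y \in X ->
  exists2 a, a \in p & (tail a \notin X) && (head a \in X).
Proof.
elim: p x => [x /eqP -> /negPf -> //|a p IH x /= /andP[/eqP ta w] xX yX].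
have [h|h] := boolP (head a \in X).
  by exists a; rewrite ?mem_head // ta xX h.
by have [b bp hb] := IH _ w h yX; exists b; rewrite // inE bp orbT.
Qed.

Lemma is_walk_rcons x p a y :
  is_walk tail head x (rcons p a) y = is_walk tail head x p (tail a) && (head a == y).
Proof.
by elim: p x => [|b p IH] x /=; rewrite ?[x == _]eq_sym // IH andbA.
Qed.

(** * Packing inside one strongly connected component *)

Section Component.
Variables (C : {set T}) (t : nat) (pred : Arc -> Arc).
Hypothesis sC : s \notin C.
Hypothesis tau_inner : forall a, tail a \in C -> head a \in C -> tau a = t.
Hypothesis pred_inj : {in [pred a | tail a \in C] &, injective pred}.
Hypothesis predP : forall a, tail a \in C ->
  head (pred a) = tail a /\ tau (pred a) <= tau a.

(* Vertices of the auxiliary static network: a terminal [inl e] for every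
   boundary arc [e] of [C] with [tau e <= t], the vertices of [C], and a sink
   [inr None] collecting the arcs that leave [C]. An arc [f] leaving [C] whose
   predecessor [e] is a boundary arc starts at the terminal [inl e], which
   forces it into the arborescence of [e]. *)
Let vtx : finType := (Arc + option T)%type.
Let hd a : vtx := if head a \in C then inr (Some (head a)) else inr None.
Let tl a : vtx :=
  if tail a \notin C then inl a
  else if head a \in C then inr (Some (tail a))
  else if tail (pred a) \notin C then inl (pred a) else inr (Some (tail a)).
Let S : {set vtx} :=
  [set z | if z is inl e then (e \in boundary C) && (tau e <= t) else false].
Let V : {set vtx} :=
  [set z | match z with inl _ => false | inr None => true | inr (Some v) => v \in C end].
(** An arc leaving [C] is left out when its predecessor is later than [t]: that predecessor is then
    a boundary arc too late for inner arcs, and continues directly with the leaving arc. *)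
Let A := [set a | if tail a \in C then tau (pred a) <= t
                  else (head a \in C) && (tau a <= t)].

Let tau_pred_inner a : tail a \in C -> head a \in C -> tau (pred a) <= t.
Proof. by move=> ta ha; rewrite -(tau_inner ta ha); case: (predP ta). Qed.

Let predA a : tail a \in C -> a \in A -> pred a \in A.
Proof.
move=> ta; rewrite !inE ta => le; have [hp _] := predP ta.
case: ifP => tp; last by rewrite hp ta.
by apply: tau_pred_inner; rewrite ?hp.
Qed.

Let aux_network : network hd S V tl A.
Proof.
split.
- by move=> [e|z]; rewrite !inE.
- move=> a; rewrite inE /tl /hd; case: (boolP (tail a \in C)) => ta /= hA; last first.
    case/andP: hA => ha le; rewrite ha !inE; split => //=.
    by rewrite ha ta le.
  split; first by case: ifP => h; rewrite inE.
  case: ifP => ha; first by rewrite !inE ta.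
  case: ifP => tp; last by rewrite !inE ta.
  by rewrite !inE /= tp hA (proj1 (predP ta)) ta.
- move=> [e|[v|]]; rewrite inE //.
    move=> vC; apply: (@card_le_inj _ _ _ _ pred).
      move=> a b; rewrite !inE /tl => /andP[_ ha] /andP[_ hb]; apply: pred_inj.
        by move: ha; rewrite inE; case: (tail a \in C).
      by move: hb; rewrite inE; case: (tail b \in C).
    move=> a; rewrite inE => /andP[aA]; rewrite /tl.
    case: (boolP (tail a \in C)) => //= ta h; have [hp _] := predP ta.
    have tav : tail a = v.
      by move: h; case: ifP => _; [|case: ifP => // _] => /eqP[].
    by rewrite inE predA //= /hd hp tav vC eqxx.
  move=> _; rewrite (_ : outs _ _ _ = set0) ?cards0 //; apply/setP => a.
  by rewrite !inE /tl; case: (tail a \in C); case: ifP; rewrite ?andbF //;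
     case: (tail (pred a) \in C); rewrite ?andbF.
- move=> [e|z]; rewrite inE // => _.
  (* Besides [e] itself, only an arc with predecessor [e] can start at [inl e], and [pred_inj]
     allows at most one. *)
  have sub : outs tl A (inl e) \subset e |: [set f | (tail f \in C) && (pred f == e)].
    apply/subsetP => a; rewrite !inE /tl => /andP[_].
    case: (boolP (tail a \in C)) => ta /=; last by case/eqP => ->; rewrite eqxx.
    case: ifP => // _; case: ifP => // _ /eqP[->]; by rewrite eqxx orbT.
  apply: leq_trans (subset_leq_card sub) _; rewrite cardsU1.
  have : #|[set f | (tail f \in C) && (pred f == e)]| <= 1.
    apply/card_le1_eqP => f f'; rewrite !inE => /andP[tf /eqP pf] /andP[tf' /eqP pf'].
    by apply: pred_inj; rewrite ?inE // pf pf'.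
  by case: (_ \notin _) => /=; lia.
Qed.

Let part (X : {set vtx}) := [set v in C | inr (Some v) \in X].

Let card_le_hits (X : {set vtx}) (D : {set Arc}) :
    (forall a, a \in D -> [/\ a \in A, tl a \in S & hd a \in X]) ->
    {in D &, injective tl} ->
  #|D| <= \sum_(y in S) hits hd tl A y X.
Proof.
move=> hD inj; rewrite sum_bool_card; apply: (card_le_inj inj) => a /hD[aA aS aX].
by rewrite inE aS; apply/hitsP; exists a.
Qed.

(** Since [pred] maps arcs of [A] starting in [Y] injectively to arcs ending in [Y], every leaving
    arc is paid for by an entry into [X]. Hence the sink can demand all leaving arcs. *)
Let sink_cut (X : {set vtx}) : X \subset V -> inr None \in X ->
  #|[set a in A | head a \notin C]| <= cut hd S tl A X.
Proof.
move=> sX sinkX; set Y := part X.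
have inY v : v \in C -> (inr (Some v) \in X) = (v \in Y) by move=> vC; rewrite inE vC.
have YC v : v \in Y -> v \in C by rewrite inE => /andP[].
have h0 : \sum_(a in A) (tail a \in Y) <= \sum_(a in A) (head a \in Y).
  rewrite !sum_bool_card; apply: (@card_le_inj _ _ _ _ pred).
    by move=> a b; rewrite !inE => /and3P[_ ta _] /and3P[_ tb _]; apply: pred_inj.
  move=> a; rewrite inE => /andP[aA tY]; have ta := YC _ tY.
  by rewrite inE predA //= (proj1 (predP ta)).
(* The terminals of these arcs are distinct: a boundary arc in [D] ends in [Y], whereas the
   predecessor of a leaving arc in [D] ends outside [Y]. *)
pose D := [set a in A | (tail a \notin C) && (head a \in Y)
    || [&& tail a \in C, head a \notin C, tail (pred a) \notin C & tail a \notin Y]].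
have h1 : #|D| <= \sum_(y in S) hits hd tl A y X.
  apply: card_le_hits.
    move=> a; rewrite inE => /andP[aA]; rewrite aA.
    case/orP => [/andP[ta hY]|/and4P[ta ha tp tY]].
      have hC := YC _ hY; rewrite /tl /hd ta hC inY // hY inE; split => //.
      by move: aA; rewrite !inE (negPf ta) hC.
    rewrite /tl /hd ta (negPf ha) tp sinkX; split => //.
    by move: aA; rewrite !inE ta (proj1 (predP ta)) ta tp.
  move=> a b; rewrite !inE /tl => /andP[_ ha] /andP[_ hb].
  case/orP: ha => [/andP[-> /andP[hC hX]]|/and4P[ta /negPf-> -> nX]];
  case/orP: hb => [/andP[-> /andP[hC' hX']]|/and4P[tb /negPf-> -> nX']];
  rewrite ?ta ?tb /= => -[E] //.
  - by move: nX'; rewrite -(proj1 (predP tb)) -E hC hX.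
  - by move: nX; rewrite -(proj1 (predP ta)) E hC' hX'.
  - exact: pred_inj.
have h2 : \sum_(a in A) (head a \notin C) + \sum_(a in A) (head a \in Y)
   <= #|D| + \sum_(a in A) enters hd S tl X a + \sum_(a in A) (tail a \in Y).
  have -> : #|D| = \sum_(a in A) (a \in D).
    rewrite sum_bool_card; apply: eq_card => a; rewrite [RHS]inE.
    by apply/esym/andb_idl; rewrite inE => /andP[].
  rewrite -!big_split; apply: leq_sum => a aA /=; rewrite [a \in D]inE aA /enters /tl /hd /=.
  case: (boolP (tail a \in C)) => ta /=; last first.
    have hC : head a \in C by move: aA; rewrite inE (negPf ta) => /andP[].
    by rewrite hC /=; case: (head a \in Y).
  case: (boolP (head a \in C)) => ha /=.
    rewrite !inY // !inE ta ha /= andbT.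
    by case: (inr (Some (head a)) \in X); case: (inr (Some (tail a)) \in X).
  have -> : (head a \in Y) = false by apply/negP => /YC; rewrite (negPf ha).
  rewrite sinkX /=; case: (boolP (tail (pred a) \in C)) => tp /=; last by case: (tail a \in Y); case: (_ && _).
  by rewrite inY // [_ \in S]inE; case: (tail a \in Y).
rewrite -sum_bool_card /cut.
by clear -h0 h1 h2; lia.
Qed.

(** A path whose last arc is later than [t] ends with a boundary arc, as inner arcs have time [t].
    On any other path all arcs have time at most [t], and one of them enters the part of [X] in
    [C]. *)
Let path_cut (X : {set vtx}) v ps : X \subset V -> inr (Some v) \in X -> path_family v ps ->
  size ps <= cut hd S tl A X + #|[set e in boundary C | (head e == v) && (t < tau e)]|.
Proof.
move=> sX vX [/allP hps dps]; set late := [set e in _ | _]; set Y := part X.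
have vY : v \in Y by rewrite inE vX andbT; move: (subsetP sX _ vX); rewrite inE.
have YC x : x \in Y -> x \in C by rewrite inE => /andP[].
pose E := [set a | [&& head a \in Y, tail a \notin Y & tau a <= t]].
apply: (@leq_trans #|E :|: late|).
  apply: size_disjoint_lists dps _ => p /hps /andP[/andP[w _] resp].
  case: (lastP p) w resp => [/= /eqP sv|q a].
    by move: sC; rewrite sv (YC _ vY).
  rewrite is_walk_rcons => /andP[w /eqP ha] resp.
  have [le|lt] := leqP (tau a) t; last first.
    exists a; rewrite ?mem_rcons ?mem_head // !inE ha (YC _ vY) eqxx lt !andbT orbC /=.
    apply/orP; left; apply: contraL lt => ta.
    by rewrite -leqNgt (tau_inner ta) // ha YC.
  have [|||b bp /andP[tb hb]] := @walk_enters Y s (rcons q a) v.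
  - by rewrite is_walk_rcons w ha eqxx.
  - by apply: contra sC; apply: YC.
  - by [].
  exists b => //; rewrite inE; apply/orP; left; rewrite inE hb tb /=.
  apply: leq_trans le.
  move: resp; rewrite /tau_respecting map_rcons.
  rewrite (sorted_pairwise leq_trans) pairwise_rcons => /andP[/allP h _].
  by move: bp; rewrite mem_rcons inE => /orP[/eqP -> //|bq]; apply/h/map_f.
apply: leq_trans (leq_card_setU _ _) _; rewrite leq_add2r.
rewrite -(cardsID [set a | tail a \in C] E) addnC; apply: leq_add.
  apply: card_le_hits.
    move=> a; rewrite !inE => /andP[ta /and3P[/andP[hC hX] _ le]].
    by rewrite /tl /hd ta hC hX !inE (negPf ta) hC le.
  move=> a b; rewrite !inE => /andP[ta _] /andP[tb _].
  by rewrite /tl ta tb => -[].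
rewrite sum_bool_card; apply/subset_leq_card/subsetP => a.
rewrite !inE => /andP[/and3P[/andP[hC hX] nY le] ta].
rewrite /enters /tl /hd ta hC hX tau_pred_inner // !inE.
by move: nY; rewrite ta /= => ->.
Qed.

(** For [f] leaving [C], [sigma f] names the branching to which [f] is attached; injectivity lets
    later branchings be grafted disjointly. *)
Lemma component_packing : exists (H : Arc -> {set Arc}) (sigma : Arc -> Arc),
  [/\ forall e, e \in boundary C -> branching e (H e) /\ H e \subset e |: inside C,
      forall e e' a, e \in boundary C -> e' \in boundary C ->
        a \in H e -> a \in H e' -> e = e',
      {in leaving C &, injective sigma},
      forall f, f \in leaving C -> sigma f \in boundary C /\
        exists2 b, b \in H (sigma f) & head b = tail f /\ tau b <= tau f
    & forall v ps, v \in C -> path_family v ps -> size ps <= #|reaching (boundary C) H v|].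
Proof.
have [R [Rle Rat]] := exists_minimum V (cut hd S tl A).
have [F pk hF] := exists_packing aux_network Rle.
have inS e : (inl e \in S) = (e \in boundary C) && (tau e <= t) by rewrite inE.
have FA y a : y \in S -> a \in F y -> a \in A.
  by move=> yS; have [/subsetP sF _ _] := pk y yS; apply: sF.
have same y y' a : y \in S -> y' \in S -> a \in F y -> a \in F y' -> y = y'.
  move=> yS y'S h h'; have [_ _ dF] := pk y yS; apply/eqP; apply: contraLR h' => ne.
  by rewrite eq_sym in ne; rewrite (disjointFr (dF y' y'S ne) h).
have root e a : inl e \in S -> a \in F (inl e) -> tail a \notin C -> a = e.
  move=> eS aF ta; have aA := FA _ _ eS aF.
  have aS : inl a \in S by move: aA; rewrite !inE (negPf ta) => /andP[-> ->].
  have tla : tl a = inl a by rewrite /tl ta.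
  by have [] := packing_terminal aux_network pk aS eS aF tla.
have parent e a x : inl e \in S -> a \in F (inl e) -> tl a = inr (Some x) ->
    exists b, [/\ b \in F (inl e), hd b = tl a, head b = x & (b == e) || (b \in inside C)].
  move=> eS aF tla; have [_ [_ hp _] _] := pk _ eS.
  case: (hp a aF); rewrite tla // => /imsetP[b bF hb]; exists b.
  move: (hb); rewrite {1}/hd; case: ifP => // hC [xb]; split => //; rewrite inE hC andbT.
  by case: (boolP (tail b \in C)) => tb; rewrite ?orbT // (root e b) ?eqxx.
(* Going backwards from an inner arc decreases the rank and can only stop at [e]. *)
have rooted e a : inl e \in S -> a \in F (inl e) -> a \in inside C -> e \in F (inl e).
  move=> eS; have [_ [_ _ [r _ hr]] _] := pk _ eS.
  have [n] := ubnP (r (hd a)); elim: n => // n IH in a * => len aF.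
  rewrite inE => /andP[ta ha].
  have tla : tl a = inr (Some (tail a)) by rewrite /tl ta ha.
  have [b [bF hb _ /orP[/eqP be|bi]]] := parent e a _ eS aF tla.
    by rewrite -{1}be.
  apply: IH bi => //; rewrite hb; apply: leq_trans (hr a aF) _.
  by rewrite -ltnS.
(* A boundary arc later than [t] stays alone. Arcs of [F (inl e)] into the sink are removed here and
   remembered by [sigma]. *)
pose H e := if tau e <= t then e |: (F (inl e) :&: inside C) else [set e].
have HP e a : a \in H e -> a = e \/ [/\ tau e <= t, a \in F (inl e) & a \in inside C].
  rewrite /H; case: ifP => le; rewrite !inE; last by move/eqP; left.
  by case/orP => [/eqP|/and3P[aF ta ha]]; [left|right; rewrite aF ta ha].
have FH e b : tau e <= t -> b \in F (inl e) -> (b == e) || (b \in inside C) -> b \in H e.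
  by move=> le bF; rewrite /H le in_setU1 in_setI bF; case: (b == e).
have eH e : e \in H e by rewrite /H; case: ifP; rewrite !inE eqxx.
have notin e : e \in boundary C -> e \notin inside C.
  by rewrite !inE => /andP[_ /negPf ->].
pose L := [set a in A | head a \notin C].
(* The sink is covered at least [#|L|] times, each time by a different arc of [L], so every arc of
   [L] is used. *)
have sinkF f : f \in L -> exists2 e, inl e \in S & f \in F (inl e).
  pose M := [set f in L | [exists y in S, f \in F y]].
  suff -> : L = M.
    rewrite inE => /andP[_ /exists_inP[[e|z]]]; first by exists e.
    by rewrite inE.
  apply/esym/eqP; rewrite eqEcard; apply/andP; split.
    by apply/subsetP => a; rewrite inE => /andP[].
  have noneV : inr None \in V by rewrite inE.
  have [X [sX nX RX]] := Rat _ noneV.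
  apply: leq_trans (sink_cut sX nX) _; rewrite -RX; apply: leq_trans (hF _ noneV) _.
  rewrite -(card_imset (mem M) (@Some_inj _)).
  pose h y := [pick a in F y | hd a == inr None].
  have hP y : y \in covering hd S F (inr None) ->
      exists a, [/\ y \in S, a \in F y, hd a = inr None & h y = Some a].
    rewrite inE => /andP[yS /imsetP[a aF ha]]; rewrite /h.
    case: pickP => [a' /andP[a'F /eqP ha']|/(_ a)]; last by rewrite aF ha eqxx.
    by exists a'.
  apply: (@card_le_inj _ _ _ _ h).
    move=> y y' /hP[a [yS aF _ ->]] /hP[a' [y'S a'F _ ->]] [E].
    by apply: (same _ _ a) => //; rewrite E.
  move=> y /hP[a [yS aF ha ->]]; apply: imset_f; rewrite inE.
  apply/andP; split; last by apply/exists_inP; exists y.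
  rewrite inE (FA y) //=; move: ha; rewrite /hd; by case: ifP => // ->.
(* By [sinkF] the default [f] never occurs for arcs leaving [C]. *)
pose sigma f := if tau (pred f) <= t
  then odflt f [pick e | (inl e \in S) && (f \in F (inl e))] else pred f.
have sigmaP f : f \in leaving C -> tau (pred f) <= t ->
    inl (sigma f) \in S /\ f \in F (inl (sigma f)).
  rewrite inE => /andP[tf hf] le; rewrite /sigma le.
  have [|e eS fF] := sinkF f; first by rewrite !inE tf le.
  by case: pickP => [e' /andP[]|/(_ e)] //=; rewrite eS fF.
exists H, sigma; split.
- move=> e eB; have [le|lt] := leqP (tau e) t; last first.
    have HE : H e = [set e] by rewrite /H leqNgt lt.
    rewrite HE; split; last by rewrite sub1set !inE eqxx.
    split; rewrite ?inE //; first by move=> a b /set1P -> /set1P ->.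
      by move=> a /set1P ->; rewrite eqxx.
    by exists (fun=> 0) => a /set1P ->; rewrite eqxx.
  have eS : inl e \in S by rewrite inS eB.
  have [_ [inj _ [r _ hr]] _] := pk _ eS.
  split; last by rewrite /H le; apply/setUS/subsetIr.
  split => //.
  + have HF a b : a \in H e -> b \in H e -> a != b -> a \in F (inl e).
      case/HP => [->|[]//] /HP[->|[_ bF bi]]; first by rewrite eqxx.
      by move=> _; apply: rooted bi.
    have Hhd a : a \in H e -> hd a = inr (Some (head a)).
      case/HP => [->|[_ _]]; first by move: eB; rewrite inE /hd => /andP[->].
      by rewrite inE /hd => /andP[_ ->].
    move=> a b aH bH hab; apply/eqP; apply: contraT => ne.
    suff E : a = b by rewrite E eqxx in ne.
    apply: inj; [exact: (HF a b)| |by rewrite !Hhd ?hab].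
    by apply: (HF b a) => //; rewrite eq_sym.
  + move=> a /HP[->|[_ aF ai]]; first by rewrite eqxx.
    move=> _; move: (ai); rewrite inE => /andP[ta ha].
    have tla : tl a = inr (Some (tail a)) by rewrite /tl ta ha.
    have [b [bF _ hb bi]] := parent e a _ eS aF tla.
    exists b; first exact: FH.
    split => //; rewrite (tau_inner ta ha); case/orP: bi => [/eqP -> //|].
    by rewrite inE => /andP[tb hb']; rewrite (tau_inner tb hb').
  + exists (fun x => r (inr (Some x))) => a /HP[->|[_ aF ai]]; first by rewrite eqxx.
    move=> _; move: (ai); rewrite inE => /andP[ta ha].
    by have := hr a aF; rewrite /tl /hd ta ha.
- move=> e e' a eB e'B /HP[->|[le aF ai]] /HP[E|[le' aF' ai']] //.
  + by move: (notin e eB); rewrite ai'.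
  + by move: (notin e' e'B); rewrite -E ai.
  + have : inl e = inl e' :> vtx by apply: (same _ _ a); rewrite // inS ?eB ?e'B.
    by case.
- move=> f f' fL f'L E.
  have [le|lt] := leqP (tau (pred f)) t; have [le'|lt'] := leqP (tau (pred f')) t.
  + have [fS fF] := sigmaP f fL le; have [_ f'F] := sigmaP f' f'L le'.
    rewrite -E in f'F; have [_ [inj _ _] _] := pk _ fS; apply: inj => //.
    by move: fL f'L; rewrite !inE /hd => /andP[_ /negPf ->] /andP[_ /negPf ->].
  + have [fS _] := sigmaP f fL le; move: fS; rewrite inS E /sigma leqNgt lt' /=.
    by rewrite leqNgt lt' andbF.
  + have [fS _] := sigmaP f' f'L le'; move: fS; rewrite inS -E /sigma leqNgt lt /=.
    by rewrite leqNgt lt andbF.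
  + move: E; rewrite /sigma (ltn_geF lt) (ltn_geF lt'); apply: pred_inj.
      by move: fL; rewrite !inE => /andP[].
    by move: f'L; rewrite !inE => /andP[].
- move=> f fL; move: (fL); rewrite inE => /andP[tf hf]; have [hp lp] := predP tf.
  have [le|lt] := leqP (tau (pred f)) t; last first.
    have sE : sigma f = pred f by rewrite /sigma leqNgt lt.
    rewrite sE; split; last by exists (pred f).
    rewrite inE hp tf; apply: contraL lt => tp; rewrite -leqNgt.
    by rewrite (tau_inner tp) ?hp.
  have [fS fF] := sigmaP f fL le; move: (fS); rewrite inS => /andP[sB sle].
  split => //; have [tp|tp] := boolP (tail (pred f) \in C).
    have tlf : tl f = inr (Some (tail f)) by rewrite /tl tf (negPf hf) tp.
    have [b [bF _ hb bi]] := parent _ f _ fS fF tlf.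
    exists b; first exact: FH.
    split => //; apply: leq_trans lp; rewrite (tau_inner tp) ?hp //.
    case/orP: bi => [/eqP -> //|].
    by rewrite inE => /andP[tb hb']; rewrite (tau_inner tb hb').
  have tlf : tl f = inl (pred f) by rewrite /tl tf (negPf hf) tp.
  have pS : inl (pred f) \in S by rewrite inS inE hp tf tp le.
  have [E] := packing_terminal aux_network pk pS fS fF tlf.
  by exists (pred f); rewrite // E.
- move=> v ps vC fam; have vV : inr (Some v) \in V by rewrite inE.
  have [X [sX vX RX]] := Rat _ vV.
  apply: leq_trans (path_cut sX vX fam) _; rewrite -RX.
  (* Coverage splits by time: arcs up to [t] meet the demand of [v], and each later boundary arc
     entering [v] covers it alone. *)
  apply: (@leq_trans (#|[set e in boundary C | (tau e <= t) && (v \in head @: H e)]|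
     + #|[set e in boundary C | (head e == v) && (t < tau e)]|)).
    rewrite leq_add2r; apply: leq_trans (hF _ vV) _.
    rewrite -(card_imset _ (@inl_inj Arc (option T))).
    apply/subset_leq_card/subsetP => -[e|z]; rewrite inE => /andP[yS].
      case/imsetP => b bF hb; apply: imset_f; move: (yS); rewrite inS => /andP[eB le].
      rewrite inE eB le /=; move: hb; rewrite /hd; case: ifP => // hC [->].
      apply: imset_f; apply: FH => //; rewrite inE hC andbT.
      by case: (boolP (tail b \in C)) => tb; rewrite ?orbT // (root e b) ?eqxx.
    by rewrite inE in yS.
  rewrite -(cardsID [set e | tau e <= t] (reaching (boundary C) H v)).
  apply: leq_add; apply/subset_leq_card/subsetP => e; rewrite !inE.
    by case/and3P => -> -> ->.
  by case/and3P => -> /eqP <- lt; rewrite -ltnNge lt imset_f.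
Qed.

End Component.

(** * Recursion over the strongly connected components *)

Lemma exists_pred : preflow tail head s tau ->
  exists2 p : Arc -> Arc, {in [pred a | tail a != s] &, injective p}
    & forall a, tail a != s -> head (p a) = tail a /\ tau (p a) <= tau a.
Proof.
move=> pf.
have /fin_all_exists[p hp] : forall v, exists p : Arc -> Arc, v != s ->
    {in [set a | tail a == v] &, injective p} /\
    forall a, tail a = v -> head (p a) = v /\ tau (p a) <= tau a.
  move=> v; have [->|vs] := eqVneq v s; first by exists id.
  have [|p pinj hp] := @nested_matching _ tau [set a | tail a == v] [set a | head a == v].
    move=> i; have := pf i v vs; congr (_ <= _); apply: eq_card => a; by rewrite !inE.
  exists p => _; split => // a ta; have [|h1 h2] := hp a; first by rewrite inE ta.
  by move: h1; rewrite inE => /eqP.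
exists (fun a => p (tail a) a) => [a b|a] as_; last by have [_ h] := hp _ as_; apply: h.
move=> bs E; have [inj ha] := hp _ as_; have [_ hb] := hp _ bs.
have tab : tail a = tail b.
  by have [<- _] := ha a erefl; have [<- _] := hb b erefl; rewrite E.
by apply: inj; rewrite ?inE ?tab // -{1}tab.
Qed.

(** [C] consists of the ancestors within [W] of a vertex having fewest. By minimality they all have
    the same ancestors, so they are mutually reachable, and consistency yields one time. *)
Lemma initial_component (W : {set T}) : consistent tail head tau -> W != set0 ->
  exists (C : {set T}) t, [/\ C \subset W, C != set0,
    forall a, tail a \in C -> head a \in C -> tau a = t
    & forall a, tail a \in W -> head a \in C -> tail a \in C].
Proof.
move=> cons /set0Pn[x0 x0W]; pose up x := [set z in W | connect (adj tail head) z x].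
case: (@arg_minnP _ x0 (mem W) (fun x => #|up x|) x0W) => x /= xW xmin.
have upx z : z \in up x -> connect (adj tail head) x z.
  move=> zx; move: (zx); rewrite inE => /andP[zW czx].
  have sub : up z \subset up x.
    by apply/subsetP => y; rewrite !inE => /andP[-> /= h]; apply: connect_trans czx.
  have : up z == up x by rewrite eqEcard sub xmin.
  by move/eqP/setP/(_ x); rewrite !inE xW connect0 => /andP[].
have conn y z : y \in up x -> z \in up x -> connect (adj tail head) y z.
  move=> yx /upx; apply: connect_trans.
  by move: yx; rewrite inE => /andP[].
pose t := if [pick a in inside (up x)] is Some a then tau a else 0.
exists (up x), t; split.
- by apply/subsetP => z; rewrite inE => /andP[].
- by apply/set0Pn; exists x; rewrite inE xW connect0.
- move=> a ta ha; rewrite /t; case: pickP => [b|/(_ a)]; last first.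
    by rewrite inE ta ha.
  by rewrite inE => /andP[tb hb]; apply: cons; rewrite /same_scc /arc_in_scc !conn.
- move=> a tW; rewrite !inE tW => /andP[_] /=; apply: connect_trans.
  by apply/connect1/existsP; exists a; rewrite !eqxx.
Qed.

Lemma branching_graft (W : {set T}) e f (H G : {set Arc}) :
    branching e H -> branching f G ->
    (forall a, a \in H -> head a \notin W) -> (forall a, a \in G -> head a \in W) ->
    (exists2 b, b \in H & head b = tail f /\ tau b <= tau f) ->
  branching e (H :|: G).
Proof.
move=> [eH injH pH [r hr]] [fG injG pG [r' hr']] hH hG [b0 b0H [hb0 lb0]]; split.
- by rewrite inE eH.
- move=> a b; rewrite !inE => /orP[aH|aG] /orP[bH|bG].
  + exact: injH.
  + by move=> E; move: (hH a aH); rewrite E hG.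
  + by move=> E; move: (hH b bH); rewrite -E hG.
  + exact: injG.
- move=> a; rewrite inE => /orP[aH|aG] ae.
    by have [b bH hb] := pH a aH ae; exists b; rewrite // inE bH.
  have [->|af] := eqVneq a f; first by exists b0; rewrite // inE b0H.
  by have [b bG hb] := pG a aG af; exists b; rewrite // inE bG orbT.
(* Ranks in [W] are shifted above all values of [r], so that [f], leading from [H] into [G],
   increases the rank. *)
- exists (fun x => if x \in W then (\max_y r y + r' x).+1 else r x) => a.
  rewrite inE => /orP[aH|aG] ae.
    have [b bH [hb _]] := pH a aH ae.
    by rewrite (negPf (hH a aH)) -hb (negPf (hH b bH)) hb; apply: hr.
  rewrite (hG a aG); have [->|af] := eqVneq a f.
    rewrite -hb0 (negPf (hH b0 b0H)) ltnS.
    by apply: leq_trans (leq_addr _ _); apply: (@leq_bigmax _ r).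
  have [b bG [hb _]] := pG a aG af.
  by rewrite -hb (hG b bG) ltnS ltn_add2l hb; apply: hr'.
Qed.

(** With an initial component [C] removed, the arcs entering the rest either leave [C] or already
    entered [W]. Branchings of the former are grafted through [sigma] onto those of [C]; the others
    are kept. *)
Lemma temporal_packing (W : {set T}) :
    consistent tail head tau -> preflow tail head s tau -> s \notin W ->
    (forall a, tail a \in W -> head a \in W) ->
  exists G : Arc -> {set Arc},
  [/\ forall e, e \in boundary W -> branching e (G e),
      forall e a, e \in boundary W -> a \in G e -> head a \in W,
      forall e e' a, e \in boundary W -> e' \in boundary W ->
        a \in G e -> a \in G e' -> e = e'
    & forall v ps, v \in W -> path_family v ps -> size ps <= #|reaching (boundary W) G v|].
Proof.
move=> cons pf; have [p pinj hp] := exists_pred pf.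
have [n] := ubnP #|W|; elim: n => // n IH in W * => len sW closed.
have [W0|Wn0] := eqVneq W set0.
  by exists (fun=> set0); split => [e|e a|e e' a|v ps]; rewrite ?W0 ?inE.
have [C [t [sCW Cn0 tauC initC]]] := initial_component cons Wn0.
have inW x : x \in C -> x \in W by apply: (subsetP sCW).
have sC : s \notin C by apply: contra sW; apply: inW.
have Cs x : x \in C -> x != s by apply: contraTneq => ->.
have [H [sigma [HP Hdisj sinj sP Hps]]] :=
  @component_packing C t p sC tauC
    (fun a b ta tb => pinj a b (Cs _ ta) (Cs _ tb)) (fun a ta => hp a (Cs _ ta)).
pose W' := W :\: C.
have [|||G' [Gbr Ghd Gdisj Gps]] := IH W'.
- rewrite ltnS in len; apply: leq_trans len; apply: proper_card; rewrite properE subsetDl.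
  have [x xC] := set0Pn _ Cn0; apply/subsetPn; exists x; first exact: inW.
  by rewrite !inE xC.
- by rewrite inE negb_and sW orbT.
- move=> a; rewrite !inE => /andP[tC tW]; rewrite closed // andbT.
  by apply: contra tC; apply: initC.
have bC e : e \in boundary C -> e \in boundary W.
  rewrite !inE => /andP[hC tC]; rewrite inW //=.
  by apply: contra tC => tW; apply: initC.
have bL f : f \in leaving C -> f \in boundary W'.
  by rewrite !inE => /andP[tC hC]; rewrite hC tC closed //; apply: inW.
have bD e : e \in boundary W -> head e \in C -> e \in boundary C.
  by rewrite !inE => /andP[_ tW] ->; apply: contra tW; apply: inW.
have bR e : e \in boundary W -> head e \notin C -> e \in boundary W'.
  by rewrite !inE => /andP[-> /negPf ->] ->; rewrite andbF.
have HC e a : e \in boundary C -> a \in H e -> head a \in C.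
  move=> eB aH; have [_ /subsetP/(_ a aH)] := HP e eB.
  rewrite !inE => /orP[/eqP ->|/andP[]//]; by move: eB; rewrite inE => /andP[].
have GW f a : f \in boundary W' -> a \in G' f -> (head a \in W) && (head a \notin C).
  by move=> fB aG; move: (Ghd f a fB aG); rewrite inE andbC.
pose G e := if head e \in C then
    (if [pick f in leaving C | sigma f == e] is Some f then H e :|: G' f else H e)
  else G' e.
have GP e a : e \in boundary W -> a \in G e ->
    (e \in boundary C /\ a \in H e) \/
    exists2 f, f \in boundary W' & a \in G' f /\
      (f \in leaving C /\ sigma f = e \/ f \notin leaving C /\ f = e).
  move=> eB; rewrite /G; case: ifP => hC; last first.
    move=> aG; right; exists e; first by apply: bR; rewrite // hC.
    split => //; right; split => //; rewrite inE negb_and.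
    by move: eB; rewrite inE => /andP[_ tW]; apply/orP; left; apply: contra tW; apply: inW.
  have eC := bD e eB hC.
  case: pickP => [f /andP[fL /eqP fe]|_ aH]; last by left.
  rewrite inE => /orP[aH|aG]; [by left|right; exists f; first exact: bL].
  by split => //; left.
have HG e : e \in boundary C -> H e \subset G e.
  move=> eC; rewrite /G (_ : head e \in C); last by move: eC; rewrite inE => /andP[].
  by case: pickP => // f _; apply: subsetUl.
have GG f : f \in leaving C -> G' f \subset G (sigma f).
  move=> fL; have [sB _] := sP f fL; rewrite /G (_ : head (sigma f) \in C); last first.
    by move: sB; rewrite inE => /andP[].
  case: pickP => [f' /andP[f'L /eqP E]|/(_ f)]; last by rewrite fL eqxx.
  by rewrite -(sinj _ _ f'L fL E) subsetUr.
exists G; split.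
- move=> e eB; rewrite /G; case: ifP => hC; last by apply: Gbr; apply: bR; rewrite // hC.
  have eC := bD e eB hC; have [br _] := HP e eC.
  case: pickP => [f /andP[fL /eqP fe]|_] //.
  apply: (branching_graft (W := W') br (Gbr f (bL f fL))).
  + by move=> a aH; rewrite inE (HC e).
  + by move=> a; apply: Ghd; apply: bL.
  + by rewrite -fe; case: (sP f fL).
- move=> e a eB /(GP e a eB)[[eC /(HC e a eC)/inW]//|[f fB [aG _]]].
  by case/andP: (GW f a fB aG).
- move=> e e' a eB e'B /(GP e a eB)[[eC aH]|[f fB [aG c]]] /(GP e' a e'B)[[e'C aH']|[f' f'B [aG' c']]].
  + exact: Hdisj aH aH'.
  + by case/andP: (GW f' a f'B aG'); rewrite (HC e).
  + by case/andP: (GW f a fB aG); rewrite (HC e').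
  + have E := Gdisj f f' a fB f'B aG aG'; subst f'.
    by case: c c' => -[fL <-] [] [f'L <-] //; [rewrite fL in f'L|rewrite f'L in fL].
- move=> v ps vW fam; have [vC|vC] := boolP (v \in C).
    apply: leq_trans (Hps v ps vC fam) _; apply/subset_leq_card/subsetP => e.
    rewrite !inE => /andP[eC vH]; apply/andP; split; last first.
      by apply: subsetP vH; apply/imsetS/HG; rewrite inE.
    by have := bC e; rewrite !inE; apply.
  have vW' : v \in W' by rewrite inE vC.
  apply: leq_trans (Gps v ps vW' fam) _.
  (* Each index is replaced by the arc whose branching absorbed it. Values of [sigma] have their
     head in [C], so they differ from the kept indices. *)
  apply: (@card_le_inj _ _ _ _ (fun f => if f \in leaving C then sigma f else f)).
    move=> f f'; rewrite ![_ \in reaching _ _ _]inE => /andP[fB _] /andP[f'B _].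
    have sne g g' : g \in leaving C -> g' \in boundary W' -> g' = sigma g -> False.
      move=> gL g'B E; have [] := sP g gL; rewrite -E inE => /andP[hC _] _.
      by move: g'B; rewrite !inE hC.
    case: (boolP (f \in leaving C)) => fL; case: (boolP (f' \in leaving C)) => f'L //.
    + exact: sinj.
    + by move/esym/(sne f f' fL f'B).
    + by move/(sne f' f f'L fB).
  move=> f; rewrite ![_ \in reaching _ _ _]inE => /andP[fB vG].
  case: (boolP (f \in leaving C)) => fL.
    have [sB _] := sP f fL; rewrite (bC _ sB) /=.
    by apply: subsetP vG; apply/imsetS/GG.
  have hC : head f \notin C by move: fB; rewrite !inE => /andP[/andP[]].
  have tC : tail f \notin C by move: fL; rewrite inE hC andbT.
  rewrite /G (negPf hC) vG andbT; move: fB; rewrite !inE.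
  by rewrite (negPf hC) (negPf tC) /= .
Qed.

(** * From branchings at arcs leaving [s] to arborescences *)

Lemma in_arboE (F : {set Arc}) v : in_arbo head F v = (v \in head @: F).
Proof.
apply/exists_inP/imsetP => -[a aF h]; exists a => //; last by rewrite h.
exact/esym/eqP.
Qed.

Lemma ranked_walk_uniq (r : T -> nat) (F : {set Arc}) x p y :
    (forall a, a \in F -> r (tail a) < r (head a)) ->
    all (fun a => a \in F) p -> is_walk tail head x p y ->
  uniq (x :: map head p) /\ last x (map head p) = y.
Proof.
move=> hr pF w.
have [h1 h2] : path (fun u v => r u < r v) x (map head p) /\ last x (map head p) = y.
  elim: p x pF w => [x _ /eqP|a p IH x /= /andP[aF pF] /andP[/eqP <- w]] //.
  by rewrite hr //; apply: IH.
split => //.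
apply: (@sorted_uniq _ (fun u v => r u < r v) _ _ (x :: map head p) h1) => [u v w'|u].
  exact: ltn_trans.
exact: ltnn.
Qed.

Section Branching.
Variables (e : Arc) (F : {set Arc}).
Hypotheses (rok : root_ok head s) (te : tail e = s) (br : branching e F).

Let tail_notin a : a \in F -> a != e -> tail a != s.
Proof.
by move=> aF ae; have [_ _ pF _] := br; have [b _ [<- _]] := pF a aF ae; apply: rok.
Qed.

Let ranked : exists r : T -> nat, forall a, a \in F -> r (tail a) < r (head a).
Proof.
(* Rank 0 at [s] and a shift elsewhere extend the rank condition to [e]. *)
have [_ _ _ [r hr]] := br; exists (fun x => if x == s then 0 else (r x).+1) => a aF.
rewrite (negPf (rok a)); have [->|ae] := eqVneq a e; first by rewrite te eqxx.
by rewrite (negPf (tail_notin aF ae)) ltnS; apply: hr.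
Qed.

Lemma branching_arborescence : tau_arborescence tail head s tau F.
Proof.
have [eF inj pF _] := br; have [r hr] := ranked; split; first split.
- move=> a aF; have [->|ae] := eqVneq a e; first by rewrite te eqxx.
  have [b bF [hb _]] := pF a aF ae; rewrite in_arboE -hb imset_f //; exact: orbT.
- move=> v /exists_inP[a aF /eqP ha]; apply/eqP/cards1P; exists a.
  apply/setP => b; rewrite !inE; apply/andP/eqP => [[bF /eqP hb]|->].
    by apply: inj; rewrite ?ha.
  by rewrite aF ha.
- move=> x [//|a p] _ pF'; apply/negP => w.
  have [/= /andP[/negP h _] lastE] := ranked_walk_uniq hr pF' w.
  by apply: h; rewrite -{1}lastE /= mem_last.
- move=> v p pF' /andP[w _]; rewrite /tau_respecting.
  elim: p (s) pF' w => //= a p IH x /andP[aF pF'] /andP[_ w].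
  have := IH (head a) pF' w; case: p pF' w {IH} => //= b p /andP[bF _] /andP[/eqP tb _] ->.
  (* The arc [b] following [a] is not [e], whose tail [s] is entered by no arc; its predecessor in
     the branching is [a] by in-degree 1. *)
  have be : b != e by apply: contraNneq (rok a) => be; rewrite -tb be te.
  have [c cF [hc lc]] := pF b bF be.
  by rewrite andbT -(inj c a) // hc tb.
Qed.

Lemma branching_path v : v \in head @: F ->
  exists2 p, all (fun a => a \in F) p
    & is_path tail head s p v && tau_respecting tau p.
Proof.
have [eF inj pF _] := br; have [r hr] := ranked; move=> vF.
suff [p pF' w] : exists2 p, all (fun a => a \in F) p & is_walk tail head s p v.
  have [u _] := ranked_walk_uniq hr pF' w; exists p => //.
  have path_p : is_path tail head s p v by rewrite /is_path w.
  by rewrite path_p; have [_ h] := branching_arborescence; apply: h path_p.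
have [n] := ubnP (r v); elim: n => // n IH in v vF * => len.
have /imsetP[a aF va] := vF; have [ae|ae] := eqVneq a e.
  by exists [:: e]; rewrite /= ?eF // te va ae !eqxx.
have [b bF [hb _]] := pF a aF ae.
have [||p pF' w] := IH (head b); first exact: imset_f.
  by rewrite hb -ltnS; apply: leq_trans len; rewrite ltnS va; apply: hr.
exists (rcons p a); first by rewrite all_rcons aF.
by rewrite is_walk_rcons -hb w va eqxx.
Qed.

End Branching.
End Temporal.

Theorem theorem4 (T Arc : finType) (tail head : Arc -> T) (s : T)
  (tau : Arc -> nat) :
  root_ok head s ->
  consistent tail head tau ->
  preflow tail head s tau ->
  exists F : 'I_#|[set a | tail a == s]| -> {set Arc},
    [/\ forall i, tau_arborescence tail head s tau (F i),
        forall i j, i != j -> [disjoint F i & F j]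
      & forall v : T, v != s ->
          is_lambda tail head s tau v #|[set i | in_arbo head (F i) v]|].
Proof.
move=> rok cons pf.
(* With all vertices but [s] in [W], the boundary is the set of arcs leaving [s]. *)
have [||G [Gbr _ Gdisj Gps]] := @temporal_packing _ _ tail head s tau [set~ s] cons pf.
- by rewrite !inE eqxx.
- by move=> a _; rewrite !inE rok.
have bE a : (a \in boundary tail head [set~ s]) = (tail a == s).
  by rewrite !inE rok negbK.
pose e (i : 'I_#|[set a | tail a == s]|) := enum_val i.
have es i : tail (e i) = s.
  by apply/eqP; have := enum_valP i; rewrite inE.
have eB i : e i \in boundary tail head [set~ s] by rewrite bE es.
have disj i j : i != j -> [disjoint G (e i) & G (e j)].
  move=> ne; rewrite disjoint_subset; apply/subsetP => a ai; rewrite inE.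
  apply: contraNN ne => aj; apply/eqP/enum_val_inj.
  exact: (Gdisj (e i) (e j) a).
exists (fun i => G (e i)); split => [i|//|v vs].
  exact: (branching_arborescence rok (es i) (Gbr _ (eB i))).
(* One path per arborescence containing [v] gives a disjoint family of the right size; [Gps] shows
   that none is larger. *)
split.
  have /fin_all_exists[p hp] : forall i, exists p : seq Arc,
      all (fun a => a \in G (e i)) p /\
      (in_arbo head (G (e i)) v -> is_path tail head s p v && tau_respecting tau p).
    move=> i; have [iv|_] := boolP (in_arbo head (G (e i)) v); last by exists [::].
    rewrite in_arboE in iv.
    by have [p] := branching_path rok (es i) (Gbr _ (eB i)) iv; exists p.
  exists [seq p i | i <- enum [set i | in_arbo head (G (e i)) v]]; split.
  - by rewrite size_map -cardE.
  - apply/allP => _ /mapP[i + ->]; rewrite mem_enum inE; exact: (hp i).2.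
  - rewrite pairwise_map; have := enum_uniq [set i | in_arbo head (G (e i)) v].
    rewrite uniq_pairwise; apply: sub_pairwise => i j ne /=.
    apply/hasPn => a /(allP (hp i).1) ai; apply/negP => /(allP (hp j).1).
    by rewrite (disjointFr (disj i j ne) ai).
move=> k [ps [<- all_ps disj_ps]].
apply: leq_trans (Gps v ps _ (conj all_ps disj_ps)) _; first by rewrite !inE.
have h a : a \in reaching head (boundary tail head [set~ s]) G v ->
    exists i, e i = a.
  rewrite inE bE => /andP[ta _]; have aS : a \in [set a | tail a == s] by rewrite inE.
  by exists (enum_rank_in aS a); rewrite /e enum_rankK_in.
rewrite -(card_imset _ (@enum_val_inj _ (mem [set a | tail a == s]))).
apply/subset_leq_card/subsetP => a aR; have [i ia] := h a aR.
apply/imsetP; exists i => //; rewrite inE in_arboE ia.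
by move: aR; rewrite inE => /andP[].
Qed.
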